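(* Let $I=(-1,1)$ and let $*_{\mathtt N}$ be the convolution on $L^2_{\mathbb{C}}(I)$ associated to the Hilbert basis $e_0=\frac1{\sqrt2}$, $e_k(x)=\cos(\frac{k\pi}2(x+1))$, $k\in\mathbb{N}^*$, i.e. $C*_{\mathtt N}u=\sum_{k\in\mathbb{N}}\langle e_k|C\rangle\langle e_k|u\rangle e_k$. Let $C\in L^2_{\mathbb{C}}(I)$ be even and define $C_1,C_2\in L^2_{\mathbb{C}}(I)$ by $$C_1(x):=\tfrac12[C(|x|)+C(1-|x|)],\qquad C_2(x):=\tfrac12[C(|x|)-C(1-|x|)] ,$$ so that $C=C_1+C_2$. For $j\in\{1,2\}$ let $\hat C_{j,\mathtt p}$ denote the extension of $C_j$ to a $2$-periodic function on $\mathbb{R}$, and put $$k_{N,C}:=-\frac{\sqrt2-1}2\int_{-1}^1C_1(y)\,dy+\frac{\sqrt2+1}2\int_{-1}^1C_2(y)\,dy .$$ Then for every $u\in L^2_{\mathbb{C}}(I)$ and $x\in I$ $$(C*_{\mathtt N}u)(x)=\frac12\int_{-1}^1\hat C_{1,\mathtt p}(x-y)u(y)\,dy+\frac12\int_{-1}^1\hat C_{1,\mathtt p}(-x-y)u(y)\,dy-\frac12\int_{-1}^1\hat C_{2,\mathtt p}(x-y)u(y)\,dy-\frac12\int_{-1}^1\hat C_{2,\mathtt p}(-x-y)u(y)\,dy+k_{N,C}\,\langle e_0|u\rangle .$$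
   Context: $\mathbb{N}=\{0,1,2,\dots\}$, $\mathbb{N}^*=\{1,2,\dots\}$. $\langle g|h\rangle=\int_{-1}^1g^*(y)h(y)\,dy$ with $^*$ complex conjugation. The value $(C*_{\mathtt N}u)(x)$ is the sum of the (absolutely convergent) series $\sum_{k\in\mathbb{N}}\langle e_k|C\rangle\langle e_k|u\rangle e_k(x)$. The $e_k$ are the normalized eigenfunctions of $-\frac4{\pi^2}\frac{d^2}{dx^2}$ on $I$ with Neumann boundary conditions. *)

(* Defs.v *)
From HB Require Import structures.
From mathcomp Require Import all_boot all_order all_algebra.
From mathcomp Require Import all_classical all_reals all_analysis.
From mathcomp Require Import complex.

Set Implicit Arguments.
Unset Strict Implicit.
Unset Printing Implicit Defensive.

Import Order.TTheory GRing.Theory Num.Theory.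
Import numFieldNormedType.Exports.
Import ComplexField.

Local Open Scope classical_set_scope.
Local Open Scope ring_scope.
Local Open Scope complex_scope.

(* Elements of L^2_C(-1,1) are represented by functions R -> R[i] constrained  *)
(* only on (-1,1): their values elsewhere are arbitrary, and identities        *)
(* between elements are identities almost everywhere on (-1,1).                *)

Definition itv11 {R : realType} : set R := `]-1, 1[%classic.

(* R[i] carries no sigma-algebra in the library, so measurability and integrals *)
(* are taken on real and imaginary parts.                                       *)
Definition L2C {R : realType} (f : R -> R[i]) : Prop :=
  [/\ measurable_fun itv11 (fun x => complex.Re (f x)),
      measurable_fun itv11 (fun x => complex.Im (f x)) &
      (@lebesgue_measure R).-integrable itv11
        (fun x => (Normc.normc (f x) ^+ 2)%:E)].

Definition cintegral {R : realType} (f : R -> R[i]) : R[i] :=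
  (\int[@lebesgue_measure R]_(y in itv11) complex.Re (f y))
  +i* (\int[@lebesgue_measure R]_(y in itv11) complex.Im (f y)).

Definition inner {R : realType} (g h : R -> R[i]) : R[i] :=
  cintegral (fun y => (g y)^* * h y).

Definition conv_term {R : realType} (e : nat -> R -> R[i]) (C u : R -> R[i])
    (x : R) (k : nat) : R[i] :=
  inner (e k) C * inner (e k) u * e k x.

(* The ascription to numFieldType selects the topology of R[i] given by its    *)
(* modulus.                                                                    *)
Definition basis_conv {R : realType} (e : nat -> R -> R[i]) (C u : R -> R[i])
    (x : R) : R[i] :=
  limn (series (conv_term e C u x : nat -> (R[i] : numFieldType))).

Definition neumann_basis {R : realType} (k : nat) (x : R) : R[i] :=
  if k == 0%N then (Num.sqrt 2)^-1%:C
  else (cos (k%:R * pi / 2 * (x + 1)))%:C.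

Definition C_1 {R : realType} (C : R -> R[i]) (x : R) : R[i] :=
  2^-1 * (C `|x| + C (1 - `|x|)).

Definition C_2 {R : realType} (C : R -> R[i]) (x : R) : R[i] :=
  2^-1 * (C `|x| - C (1 - `|x|)).

(* The argument is shifted by an even integer into [-1, 1); the values obtained *)
(* at odd integers are irrelevant, as these form a null set.                    *)
Definition periodic_ext {R : realType} (f : R -> R[i]) (x : R) : R[i] :=
  f (x - 2 * (Num.floor ((x + 1) / 2))%:~R).

Definition k_N {R : realType} (C : R -> R[i]) : R[i] :=
  - ((Num.sqrt 2 - 1) / 2)%:C * cintegral (C_1 C)
  + ((Num.sqrt 2 + 1) / 2)%:C * cintegral (C_2 C).

(* Main.v *)
Require Import Defs.
From HB Require Import structures.
From mathcomp Require Import all_boot all_order all_algebra.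
From mathcomp Require Import all_classical all_reals all_analysis.
From mathcomp Require Import complex.
From mathcomp Require Import measurable_realfun.
From mathcomp Require Import zify ring lra.

Set Implicit Arguments.
Unset Strict Implicit.
Unset Printing Implicit Defensive.

Import Order.TTheory GRing.Theory Num.Theory.
Import numFieldNormedType.Exports.

Local Open Scope classical_set_scope.
Local Open Scope ring_scope.
Local Open Scope complex_scope.

(** On [(-1, 1)] one has [C_1 - C_2 = C (1 - |.|)] =: D, so the four integrals
    amount to [(1/2) int (D (x - y) + D (-x - y)) u y dy] with [D] extended
    periodically.  The difference between this expression, completed by the
    constant term, and the [n]-th partial sum of the cosine series is bilinear
    in [(C, u)].  By Bessel and by the fact that the folding maps
    [y |-> x - y mod 2] and [z |-> 1 - |z|] at most multiply integrals by a
    constant, it is bounded by [13 t |C|^2 + 3 |u|^2 / t] for every [t > 0],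
    uniformly in [n].  It vanishes for large [n] when [C] is one of the basis
    functions [e_2m], by the product-to-sum formulas.  The span of the [e_2m]
    is dense in the even functions: approximate [C] by a bounded continuous
    [g], then [g |z|] by its Bernstein polynomials in the variable
    [(1 + cos (pi z)) / 2], using dominated convergence.  Hence the difference
    tends to 0 for every even [C], and the complex case follows by taking real
    and imaginary parts. *)

(** * Real square-integrable functions on the interval *)

Lemma measurable_itv11 {R : realType} : measurable (itv11 : set (measurableTypeR R)).
Proof. exact: measurable_itv. Qed.
#[local] Hint Resolve measurable_itv11 : core.

Section RealL2.
Context {R : realType}.
Notation mu := (@lebesgue_measure R).
Implicit Types (f g h : R -> R).

(** Measurability is asked on the whole line, so that composing with a measurable map needs no
    control of its range; only integrability refers to the interval. *)
Definition sq_integrable f : Prop :=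
  measurable_fun (setT : set (measurableTypeR R)) f /\
  mu.-integrable itv11 (fun x => (f x ^+ 2)%:E).

Definition ip f g : R := \int[mu]_(y in itv11) (f y * g y).

Lemma sq_integrable_measurable f : sq_integrable f ->
  measurable_fun (itv11 : set (measurableTypeR R)) f.
Proof. by move=> [mf _]; exact: measurable_funTS. Qed.

Lemma sq_integrableM f g : sq_integrable f -> sq_integrable g ->
  mu.-integrable itv11 (EFin \o (fun x => f x * g x)).
Proof.
move=> Lf Lg.
have If := Lf.2; have Ig := Lg.2.
apply: le_integrable (integrableD _ If Ig) => //.
  apply/measurable_EFinP; apply: measurable_funM; exact: sq_integrable_measurable.
move=> x _; rewrite -EFinD /= lee_fin.
rewrite normrM (ger0_norm (addr_ge0 (sqr_ge0 _) (sqr_ge0 _))).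
rewrite -[f x ^+ 2]real_normK ?num_real// -[g x ^+ 2]real_normK ?num_real//.
have := normr_ge0 (f x); have := normr_ge0 (g x); nra.
Qed.

Lemma sq_integrableD f g : sq_integrable f -> sq_integrable g ->
  sq_integrable (fun x => f x + g x).
Proof.
move=> Lf Lg; split; first by apply: measurable_funD; [case: Lf|case: Lg].
have If := Lf.2; have Ig := Lg.2.
apply: le_integrable (integrableZl _ 2 (integrableD _ If Ig)) => //.
  apply/measurable_EFinP; apply: measurable_funX.
  by apply: measurable_funD; exact: sq_integrable_measurable.
move=> x _; rewrite -EFinD -EFinM /= lee_fin.
rewrite ger0_norm ?sqr_ge0// ger0_norm; last first.
  by rewrite mulr_ge0// addr_ge0// sqr_ge0.
have := sqr_ge0 (f x - g x); nra.
Qed.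

Lemma sq_integrableZ a f : sq_integrable f -> sq_integrable (fun x => a * f x).
Proof.
move=> [mf If]; split; first exact: measurable_funM.
have := integrableZl measurable_itv11 (a ^+ 2) If.
by apply: eq_integrable => // x _; rewrite -EFinM exprMn.
Qed.

Lemma sq_integrableN f : sq_integrable f -> sq_integrable (fun x => - f x).
Proof. by move=> /(sq_integrableZ (-1)); under eq_fun do rewrite mulN1r. Qed.

Lemma sq_integrableB f g : sq_integrable f -> sq_integrable g ->
  sq_integrable (fun x => f x - g x).
Proof. by move=> Lf /sq_integrableN; exact: sq_integrableD. Qed.

Lemma mu_itv11 : mu itv11 = 2%:E.
Proof.
rewrite /itv11 lebesgue_measure_itv/= lte_fin ifT; last by lra.
by rewrite -EFinB opprK.
Qed.

Lemma sq_integrable_bounded (M : R) f : measurable_fun (setT : set (measurableTypeR R)) f ->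
  (forall x, `|f x| <= M) -> sq_integrable f.
Proof.
move=> mf fM; split=> //.
apply: (@measurable_bounded_integrable _ _ _ mu (fun x => f x ^+ 2)) => //.
- by apply: (@eq_ind_r _ 2%:E (fun z => (z < +oo)%E)); [exact: ltry|exact: mu_itv11].
- by apply: measurable_funX; exact: measurable_funTS.
exists (M ^+ 2); split; first exact: num_real.
move=> N MN x _ /=; rewrite ger0_norm ?sqr_ge0// (le_trans _ (ltW MN))//.
rewrite -[f x ^+ 2]real_normK ?num_real//.
have := fM x; have := normr_ge0 (f x); nra.
Qed.

Lemma sq_integrable_cst c : sq_integrable (fun=> c).
Proof. by apply: (@sq_integrable_bounded `|c|) => //. Qed.

Lemma ipC f g : ip f g = ip g f.
Proof. by apply: eq_Rintegral => x _; rewrite mulrC. Qed.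

Lemma ipDl f g h : sq_integrable f -> sq_integrable g -> sq_integrable h ->
  ip (fun x => f x + g x) h = ip f h + ip g h.
Proof.
move=> Lf Lg Lh; rewrite /ip -RintegralD//; [|exact: sq_integrableM..].
by apply: eq_Rintegral => x _; rewrite mulrDl.
Qed.

Lemma ipZl a f h : sq_integrable f -> sq_integrable h ->
  ip (fun x => a * f x) h = a * ip f h.
Proof.
move=> Lf Lh; rewrite /ip -RintegralZl//; last exact: sq_integrableM.
by apply: eq_Rintegral => x _; rewrite mulrA.
Qed.

Lemma ipNl f h : sq_integrable f -> sq_integrable h ->
  ip (fun x => - f x) h = - ip f h.
Proof.
by move=> Lf Lh; rewrite -mulN1r -ipZl//; congr ip; apply/funext => x; rewrite mulN1r.
Qed.

Lemma ipBl f g h : sq_integrable f -> sq_integrable g -> sq_integrable h ->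
  ip (fun x => f x - g x) h = ip f h - ip g h.
Proof.
by move=> Lf Lg Lh; rewrite ipDl ?ipNl//; exact: sq_integrableN.
Qed.

Lemma ipDr f g h : sq_integrable f -> sq_integrable g -> sq_integrable h ->
  ip h (fun x => f x + g x) = ip h f + ip h g.
Proof. by move=> Lf Lg Lh; rewrite ipC ipDl// !(ipC h). Qed.

Lemma ipZr a f h : sq_integrable f -> sq_integrable h ->
  ip h (fun x => a * f x) = a * ip h f.
Proof. by move=> Lf Lh; rewrite ipC ipZl// !(ipC h). Qed.

Lemma ipBr f g h : sq_integrable f -> sq_integrable g -> sq_integrable h ->
  ip h (fun x => f x - g x) = ip h f - ip h g.
Proof. by move=> Lf Lg Lh; rewrite ipC ipBl// !(ipC h). Qed.

Lemma ip_ge0 f : 0 <= ip f f.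
Proof. by apply: Rintegral_ge0 => x _; rewrite -expr2 sqr_ge0. Qed.

Lemma ae_eq_itv11S (T T' : Type) (f g : R -> T) (f' g' : R -> T') :
  (forall x, itv11 x -> f x = g x -> f' x = g' x) ->
  f = g %[ae mu in itv11] -> f' = g' %[ae mu in itv11].
Proof.
move=> fg [N [mN N0 sN]]; exists N; split=> // x /= H.
by apply: sN => /= K; apply: H => xI; apply: fg => //; exact: K.
Qed.

Lemma ae_eq_ipl f f' g : sq_integrable f -> sq_integrable f' -> sq_integrable g ->
  f = f' %[ae mu in itv11] -> ip f g = ip f' g.
Proof.
move=> Lf Lf' Lg ff'; congr fine; apply: ae_eq_integral => //.
- by case/integrableP: (sq_integrableM Lf Lg).
- by case/integrableP: (sq_integrableM Lf' Lg).
- by apply: ae_eq_itv11S ff' => x _ ->.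
Qed.

(** Integrated form of [2ab <= t a^2 + b^2 / t]. It replaces Cauchy-Schwarz and avoids square roots;
    the weight [t] is fixed only in the final limit argument. *)
Lemma ip_amgm f g (t : R) : 0 < t -> sq_integrable f -> sq_integrable g ->
  `|ip f g| <= t * ip f f + ip g g / t.
Proof.
move=> t0 Lf Lg.
have key a b : a * b *+ 2 <= t * a ^+ 2 + b ^+ 2 / t.
  have -> : t * a ^+ 2 + b ^+ 2 / t = a * b *+ 2 + t * (a - b / t) ^+ 2.
    by field; rewrite gt_eqF.
  by rewrite lerDl mulr_ge0 ?sqr_ge0// ltW.
(* Stated for any [h] with the same norm as [f], hence usable for both [f] and [- f]; the two bounds
   give the absolute value. *)
have aux h : sq_integrable h -> ip h h = ip f f ->
    ip h g *+ 2 <= t * ip f f + ip g g / t.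
  move=> Lh hh; rewrite -hh -[ip h g *+ 2]mulr_natl [ip g g / t]mulrC.
  have Lth := sq_integrableZ t Lh; have Ltg := sq_integrableZ t^-1 Lg.
  have L2h := sq_integrableZ 2 Lh.
  rewrite -!ipZl// /ip -RintegralD//; [|exact: sq_integrableM..].
  apply: le_Rintegral => //; first exact: sq_integrableM.
    have := integrableD measurable_itv11 (sq_integrableM Lth Lh) (sq_integrableM Ltg Lg).
    exact: eq_integrable.
  move=> x _; have := key (h x) (g x); rewrite -mulr_natl; lra.
have h1 := aux f Lf erefl.
have E : ip (fun x => - f x) (fun x => - f x) = ip f f.
  by apply: eq_Rintegral => x _; rewrite mulrNN.
have h2 := aux _ (sq_integrableN Lf) E; rewrite ipNl// in h2.
by rewrite ler_norml; apply/andP; split; lra.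
Qed.

End RealL2.

(** * Folding maps *)

Section AffineChange.
Context {R : realType}.
Notation mu := (@lebesgue_measure R).
Local Open Scope ereal_scope.

(** These are all the isometries of the line; the boolean tells whether the orientation is
    reversed. *)
Definition signed_shift (p : R * bool) (y : R) : R := (p.1 + (-1) ^+ p.2 * y)%R.

Lemma measurable_signed_shift p :
  measurable_fun (setT : set (measurableTypeR R))
    (signed_shift p : _ -> measurableTypeR R).
Proof. by apply: measurable_funD => //; exact: measurable_funM. Qed.

(** By uniqueness of Lebesgue measure it suffices to test half-open intervals. A reflection moves
    the closed end to the other side, which leaves the length unchanged. *)
Lemma lebesgue_measure_signed_shift p (A : set (measurableTypeR R)) :
  measurable A ->
  pushforward mu (signed_shift p : _ -> measurableTypeR R) A = mu A.
Proof.
move=> mA; apply/esym/lebesgue_measure_unique => //=.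
  exact: measurable_signed_shift.
move=> mf _ [[a b]] _ <-; rewrite /pushforward /signed_shift.
case: p mf => c [] mf /=.
  rewrite (_ : _ @^-1` _ = `[c - b, c - a[%classic)%R; last first.
    by apply/seteqP; split=> y /=; rewrite !in_itv/= expr1; lra.
  rewrite !lebesgue_measure_itv/= !lte_fin ltrD2l ltrN2.
  by case: ifP => // _; rewrite -!EFinB; congr EFin; lra.
rewrite (_ : _ @^-1` _ = `]a - c, b - c]%classic)%R; last first.
  by apply/seteqP; split=> y /=; rewrite !in_itv/= expr0; lra.
rewrite !lebesgue_measure_itv/= !lte_fin ltrD2r.
by case: ifP => // _; rewrite -!EFinB; congr EFin; lra.
Qed.

Lemma ge0_integral_signed_shift p (f : measurableTypeR R -> \bar R) :
  measurable_fun setT f -> (forall r, 0 <= f r) ->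
  \int[mu]_r f (signed_shift p r) = \int[mu]_r f r.
Proof.
move=> mf f0; rewrite -[setT in LHS](preimage_setT (signed_shift p)).
rewrite -[LHS](@ge0_integral_pushforward _ _ _ _ _ _ (measurable_signed_shift p))//.
apply: eq_measure_integral; first exact: measurable_signed_shift.
by move=> mf' A mA _; exact: lebesgue_measure_signed_shift.
Qed.

(* A map that folds an interval into [-1, 1] along finitely many isometries
   multiplies integrals of nonnegative functions by at most their number. *)
Lemma fold_integral_le (cs : seq (R * bool)) (tau : R -> R)
    (g : measurableTypeR R -> \bar R) :
  measurable_fun (setT : set (measurableTypeR R)) (tau : _ -> measurableTypeR R) ->
  measurable_fun setT g -> (forall r, 0 <= g r) ->
  (forall y, itv11 y -> (-1 <= tau y <= 1)%R /\
     has (fun p => tau y == signed_shift p y) cs) ->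
  \int[mu]_(y in itv11) g (tau y) <=
    ((size cs)%:R)%:E * \int[mu]_(y in itv11) g y.
Proof.
move=> mtau mg g0 H.
(* The cut is to the closed interval because [tau] may reach an endpoint; the endpoints are dropped
   again once the integral of [g1] is computed. *)
pose g1 := g \_ `[(-1)%R, 1%R]%classic.
have g10 r : 0 <= g1 r by rewrite /g1 patchE; case: ifP.
have mg1 : measurable_fun (setT : set (measurableTypeR R)) g1.
  apply/(measurable_restrictT _ _).1 => //; exact: measurable_funTS.
have mgs p : measurable_fun (setT : set (measurableTypeR R))
    (fun y => g1 (signed_shift p y)).
  by apply: measurableT_comp => //; exact: measurable_signed_shift.
apply: (@le_trans _ _ (\int[mu]_(y in itv11) \sum_(p <- cs) g1 (signed_shift p y))).
  apply: ge0_le_integral => //.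
  - exact: measurable_funTS (measurableT_comp mg mtau).
  - by apply: measurable_funTS; apply: emeasurable_sum => p _; exact: mgs.
  move=> y /H[t1 /hasP[p pcs /eqP ty]].
  (* The isometry that agrees with [tau] at [y] already contributes [g (tau y)]; the remaining terms
     are nonnegative. *)
  rewrite (big_rem p)//= -ty {1}/g1 patchE ifT; last by rewrite inE/= in_itv.
  by rewrite leeDl//; exact: sume_ge0.
apply: (@le_trans _ _ (\int[mu]_y \sum_(p <- cs) g1 (signed_shift p y))).
  apply: ge0_subset_integral => //; first by apply: emeasurable_sum => p _; exact: mgs.
  by move=> y _; exact: sume_ge0.
rewrite ge0_integral_sum//.
under eq_bigr do rewrite ge0_integral_signed_shift//.
rewrite big_const_seq count_predT.
have -> : \int[mu]_r g1 r = \int[mu]_(y in itv11) g y.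
  rewrite /g1 -integral_mkcond integral_itv_bndoo//.
  exact: measurable_funTS.
set J := \int[mu]_(y in itv11) g y.
(* [J] may be infinite, so the iterated sum is compared with the product by induction in the
   extended reals. *)
elim: (size cs) => [|n IH] /=; first by rewrite mul0e.
have J0 : 0 <= J by exact: integral_ge0.
apply: (le_trans (leeD2l J IH)).
by rewrite -natr1 EFinD ge0_muleDl ?lee_fin// mul1e addeC.
Qed.

End AffineChange.

Section Fold.
Context {R : realType}.
Notation mu := (@lebesgue_measure R).
Implicit Types (f g h u : R -> R) (tau : R -> R).

Definition fold_map (n : nat) tau : Prop :=
  measurable_fun (setT : set (measurableTypeR R)) (tau : _ -> measurableTypeR R) /\
  exists2 cs : seq (R * bool), size cs = n & forall y, itv11 y ->
    (-1 <= tau y <= 1)%R /\ has (fun p => tau y == signed_shift p y) cs.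

Lemma fold_integrable n tau f : fold_map n tau ->
  measurable_fun (setT : set (measurableTypeR R)) f ->
  mu.-integrable itv11 (EFin \o f) ->
  mu.-integrable itv11 (EFin \o (fun y => f (tau y))).
Proof.
move=> [mt [cs _ Hcs]] mf /integrableP[_ fi]; apply/integrableP; split.
  by apply/measurable_EFinP/measurable_funTS; exact: (measurableT_comp mf mt).
have mg : measurable_fun (setT : set (measurableTypeR R)) (fun y => (`|f y|)%:E).
  by apply/measurable_EFinP; exact: measurableT_comp.
apply: le_lt_trans (fold_integral_le (g := fun y => (`|f y|)%:E) mt mg _ Hcs) _ => //.
rewrite lte_mul_pinfty//.
Qed.

Lemma sq_integrable_fold n tau f : fold_map n tau ->
  sq_integrable f -> sq_integrable (fun y => f (tau y)).
Proof.
move=> ft [mf If]; split; first exact: (measurableT_comp mf ft.1).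
have := fold_integrable (f := fun y => f y ^+ 2) ft _ If; apply.
exact: measurable_funX.
Qed.

Lemma ip_fold_le n tau f : fold_map n tau -> sq_integrable f ->
  ip (fun y => f (tau y)) (fun y => f (tau y)) <= n%:R * ip f f.
Proof.
move=> ft Lf; have Lft := sq_integrable_fold ft Lf.
case: ft => mt [cs <- Hcs].
have mg : measurable_fun (setT : set (measurableTypeR R)) (fun y => (f y * f y)%:E).
  by apply/measurable_EFinP; apply: measurable_funM; case: Lf.
have g0 r : (0 <= (f r * f r)%:E)%E by rewrite lee_fin -expr2 sqr_ge0.
have := fold_integral_le mt mg g0 Hcs.
rewrite -lee_fin /ip /Rintegral EFinM !fineK//.
- exact: integrable_fin_num (sq_integrableM Lf Lf).
- exact: integrable_fin_num (sq_integrableM Lft Lft).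
Qed.

(** The representative of [z] modulo 2 in [[-1, 1)], written with the same shift as in
    [periodic_ext]. *)
Definition red (z : R) : R := z - 2 * (Num.floor ((z + 1) / 2))%:~R.

Lemma red_itv z : -1 <= red z < 1.
Proof.
rewrite /red; have := floor_le ((z + 1) / 2); have := floorD1_gt ((z + 1) / 2).
rewrite intrD; lra.
Qed.

Lemma measurable_red :
  measurable_fun (setT : set (measurableTypeR R)) (red : _ -> measurableTypeR R).
Proof.
apply: measurable_funB => //; apply: measurable_funM => //.
apply: nondecreasing_measurable => // x y xy.
by rewrite ler_int; apply: le_floor; lra.
Qed.

Lemma fold_abs : fold_map 2 (fun z => `|z|).
Proof.
split; first exact: normr_measurable.
exists [:: (0, false); (0, true)] => // y; rewrite /itv11/= in_itv/= => yI.
rewrite /signed_shift/= expr1 expr0; have [y0|y0] := ger0P y.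
  by split; [lra|apply/orP; left; apply/eqP; lra].
by split; [lra|apply/orP; right; apply/orP; left; apply/eqP; lra].
Qed.

Lemma fold_1subabs : fold_map 2 (fun z => 1 - `|z|).
Proof.
split; first by apply: measurable_funB => //; exact: normr_measurable.
exists [:: (1, true); (1, false)] => // y; rewrite /itv11/= in_itv/= => yI.
rewrite /signed_shift/= expr1 expr0; have [y0|y0] := ger0P y.
  by split; [lra|apply/orP; left; apply/eqP; lra].
by split; [lra|apply/orP; right; apply/orP; left; apply/eqP; lra].
Qed.

(** Since [x - y] lies in [(-2, 2)], reducing it modulo 2 subtracts 0, 2 or -2, which gives three
    reflections of [y]. *)
Lemma fold_red x : itv11 x -> fold_map 3 (fun y => red (x - y)).
Proof.
rewrite /itv11/= in_itv/= => xI; split.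
  by apply: (measurableT_comp measurable_red); exact: measurable_funB.
exists [:: (x, true); (x - 2, true); (x + 2, true)] => // y.
rewrite /itv11/= in_itv/= => yI; split; first by have := red_itv (x - y); lra.
rewrite /signed_shift/red/= expr1.
have H1 := floor_le ((x - y + 1) / 2).
have H2 := floorD1_gt ((x - y + 1) / 2).
move: H1 H2; set k := Num.floor _ => H1 H2.
have k1 : (k < 2)%R by rewrite -(ltr_int R); lra.
have k2 : (-2 < k)%R by rewrite -(ltr_int R); move: H2; rewrite intrD; lra.
have : [|| k == 0, k == 1 | k == -1] by lia.
by move=> /or3P[]/eqP->; apply/or4P; [apply: Or41|apply: Or42|apply: Or43];
  apply/eqP; rewrite ?mulrN1z ?mulr0z; lra.
Qed.

End Fold.

(** * The Neumann basis and Bessel's inequality *)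

Section NeumannBasis.
Context {R : realType}.
Notation mu := (@lebesgue_measure R).
Implicit Types (f g h u : R -> R).

Definition nb (k : nat) (x : R) : R :=
  if k == 0%N then (Num.sqrt 2)^-1 else cos (k%:R * pi / 2 * (x + 1)).

Lemma continuous_cos_affine (a b : R) : continuous (fun x : R => cos (a * (x + b))).
Proof.
move=> x; apply: (continuous_comp (f := fun x : R => a * (x + b))).
  apply: continuousM; first exact: cvg_cst.
  by apply: continuousD; [exact: cvg_id|exact: cvg_cst].
exact: continuous_cos.
Qed.

Lemma is_derive_affine (a x : R) : is_derive x 1 (fun x : R => a * (x + 1)) a.
Proof.
have -> : (fun x : R => a * (x + 1)) = (a *: (id + cst 1))%R :> (R^o -> R^o).
  by apply/funext.
by apply: is_derive_eq; rewrite addr0 /GRing.scale/= mulr1.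
Qed.

Lemma is_derive_sin_affine (a x : R) : a != 0 ->
  is_derive x 1 (fun x => a^-1 * sin (a * (x + 1))) (cos (a * (x + 1))).
Proof.
move=> a0.
have H := @is_derive1_comp _ sin (fun x : R => a * (x + 1)) x _ _
  (is_derive_sin (a * (x + 1))) (is_derive_affine a x).
have -> : (fun x : R => a^-1 * sin (a * (x + 1))) =
    (a^-1 *: (sin \o (fun x : R => a * (x + 1)) : R^o -> R^o)) :> (R^o -> R^o).
  by apply/funext.
by apply: is_derive_eq; rewrite /GRing.scale/= mulrCA mulVf ?mulr1.
Qed.

Lemma sq_integrable_cos_affine (a b : R) : sq_integrable (fun x : R => cos (a * (x + b))).
Proof.
apply: (@sq_integrable_bounded _ 1).
  by apply: continuous_measurable_fun; exact: continuous_cos_affine.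
by move=> x; rewrite ler_norml cos_geN1 cos_le1.
Qed.

Lemma sq_integrable_nb k : sq_integrable (nb k).
Proof.
rewrite /nb; case: eqP => _; first exact: sq_integrable_cst.
exact: sq_integrable_cos_affine.
Qed.

Lemma sin_natpi (n : nat) : sin (n%:R * pi) = 0 :> R.
Proof.
elim: n => [|n IH]; first by rewrite mul0r sin0.
by rewrite -natr1 mulrDl mul1r sinDpi IH oppr0.
Qed.

Lemma Rintegral_itv11_cst (c : R) : \int[mu]_(x in itv11) c = c * 2.
Proof.
rewrite Rintegral_cst; last exact: measurable_itv.
by transitivity (c * fine 2%:E) => //; congr (_ * fine _); exact: mu_itv11.
Qed.

(** For [m > 0] the antiderivative [sin (a (x + 1)) / a] vanishes at both ends, because [2 a] is a
    multiple of [pi]. *)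
Lemma Rintegral_cos_half (m : nat) :
  \int[mu]_(x in itv11) cos (m%:R * pi / 2 * (x + 1)) = if m == 0%N then 2 else 0.
Proof.
case: m => [|m] /=.
  under eq_Rintegral do rewrite !mul0r cos0.
  by rewrite Rintegral_itv11_cst mul1r.
set a : R := _ * pi / 2.
have a0 : a != 0 by rewrite /a !mulf_neq0 ?invr_neq0// ?pnatr_eq0// gt_eqF// pi_gt0.
pose F x : R := a^-1 * sin (a * (x + 1)).
have dF (x : R) : is_derive x 1 F (cos (a * (x + 1))) by exact: is_derive_sin_affine.
have cF : continuous F.
  by move=> x; apply: differentiable_continuous; apply/derivable1_diffP; case: (dF x).
have := @continuous_FTC2 R (fun x => cos (a * (x + 1))) F (-1) 1.
have -> : F 1 = 0.
  rewrite /F (_ : a * (1 + 1) = m.+1%:R * pi); first by rewrite sin_natpi mulr0.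
  by rewrite /a; field.
have -> : F (-1) = 0 by rewrite /F addNr mulr0 sin0 mulr0.
move=> /(_ _ _ _ _)/wrap[].
- by lra.
- by apply: continuous_subspaceT; exact: continuous_cos_affine.
- split; first by move=> x _; case: (dF x).
  + exact: cvg_at_right_filter (cF _).
  + exact: cvg_at_left_filter (cF _).
- by move=> x _; rewrite derive1E; case: (dF x).
move=> E; rewrite /Rintegral.
transitivity (fine (\int[mu]_(x in `[(-1)%R, 1%R]) (cos (a * (x + 1)))%:E)%E).
  congr fine; apply/esym/integral_itv_bndoo.
  apply/measurable_EFinP; exact: sq_integrable_measurable (sq_integrable_cos_affine a 1).
by rewrite E /= subr0.
Qed.

Lemma cosMcos (a b : R) : cos a * cos b = 2^-1 * (cos (a - b) + cos (a + b)).
Proof. by rewrite cosB cosD; field. Qed.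

Lemma sqrt2_sq : Num.sqrt 2 * Num.sqrt 2 = 2 :> R.
Proof. by rewrite -expr2 sqr_sqrtr. Qed.

Lemma sqrt2_neq0 : Num.sqrt 2 != 0 :> R.
Proof. by rewrite gt_eqF// sqrtr_gt0. Qed.

(** Orthonormality. Product-to-sum turns positive indices into the frequencies [k - j] and [j + k],
    and only the first can be zero. *)
Lemma ip_nb j k : ip (nb j) (nb k) = (j == k)%:R.
Proof.
(* The ordering makes [k - j] a genuine subtraction of natural numbers. *)
wlog jk : j k / (j <= k)%N.
  move=> H; have [|/ltnW] := leqP j k; first exact: H.
  by rewrite ipC eq_sym; exact: H.
case: j jk => [|j] jk.
  have -> : ip (nb 0) (nb k) = (Num.sqrt 2)^-1 * \int[mu]_(x in itv11) nb k x.
    rewrite -RintegralZl//.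
    have := sq_integrableM (sq_integrable_cst 1) (sq_integrable_nb k).
    by apply: eq_integrable => // x _; rewrite /= mul1r.
  case: k jk => [|k] _.
    by rewrite /nb/= Rintegral_itv11_cst mulrA -invfM sqrt2_sq mulVf.
  by rewrite /nb/= Rintegral_cos_half/= mulr0.
case: k jk => // k jk.
have E (x : R) : nb j.+1 x * nb k.+1 x =
    2^-1 * (cos ((k - j)%N%:R * pi / 2 * (x + 1)) + cos ((j.+1 + k.+1)%N%:R * pi / 2 * (x + 1))).
  rewrite /nb/= mulrC cosMcos natrB// natrD.
  have nS (m : nat) : m.+1%:R = m%:R + 1 :> R by rewrite natr1.
  by congr (_ * (cos _ + cos _)); rewrite !nS; ring.
rewrite /ip; under eq_Rintegral do rewrite E.
have Ic (m : nat) : mu.-integrable itv11 (EFin \o (fun x : R => cos (m%:R * pi / 2 * (x + 1)))).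
  have := sq_integrableM (sq_integrable_cst 1) (sq_integrable_cos_affine (m%:R * pi / 2) 1).
  by apply: eq_integrable => // x _; rewrite /= mul1r.
rewrite RintegralZl//; last first.
  by have := integrableD measurable_itv11 (Ic (k - j)%N) (Ic (j.+1 + k.+1)%N); exact: eq_integrable.
rewrite RintegralD// !Rintegral_cos_half addSn/= addr0 eqSS.
have -> : (k - j == 0)%N = (j == k) by lia.
by case: eqP => _; rewrite ?mulr0// mulVf.
Qed.

Lemma nb_le1 k x : `|nb k x| <= 1.
Proof.
rewrite /nb; case: eqP => _; last by rewrite ler_norml cos_geN1 cos_le1.
rewrite ger0_norm ?invr_ge0// invf_le1 ?sqrtr_gt0//.
by rewrite -[X in X <= _]sqrtr1 ler_sqrt// ler1n.
Qed.

(** The projections on the basis functions are removed one at a time; each removal lowers the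
    squared norm by the square of a coefficient, and the remainder has nonnegative norm. *)
Lemma bessel f n : sq_integrable f -> \sum_(0 <= k < n) ip (nb k) f ^+ 2 <= ip f f.
Proof.
move=> Lf.
(* [g] is the remainder after [n] removals. Its coefficients of index at least [n] are still those
   of [f], which lets the induction go on. *)
suff [g [Lg gf gk]] : exists g, [/\ sq_integrable g,
    ip g g + \sum_(0 <= k < n) ip (nb k) f ^+ 2 = ip f f &
    forall k, (n <= k)%N -> ip (nb k) g = ip (nb k) f].
  by rewrite -gf lerDr ip_ge0.
elim: n => [|n [g [Lg gf gk]]].
  by exists f; split => //; rewrite big_nil addr0.
have Ln := sq_integrable_nb n.
pose c := ip (nb n) f.
have Lcn := sq_integrableZ c Ln.
exists (fun x => g x - c * nb n x); split.
- exact: sq_integrableB.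
- rewrite big_nat_recr//= -gf !(ipBl, ipBr, ipZl, ipZr)//; try exact: sq_integrableB.
  by rewrite (ipC g (nb n)) gk// ip_nb eqxx -/c mulr1n; ring.
- move=> k nk; rewrite ipBr ?ipZr//; last exact: sq_integrable_nb.
  rewrite gk 1?ltnW// ip_nb (_ : (k == n) = false) ?mulr0 ?subr0//; lia.
exact: sq_integrable_nb.
Qed.

End NeumannBasis.

(** * Density of even trigonometric polynomials *)

Section Bernstein.
Context {R : realType}.
Implicit Types (f g : nat -> R) (t : R).

(* The Bernstein operator as the expectation of [f] under the sum of [n]
   Bernoulli variables of parameter [t], computed by conditioning on one. *)
Fixpoint bern n f t : R :=
  if n is n'.+1 then t * bern n' (f \o S) t + (1 - t) * bern n' f t else f 0%N.

Lemma bernD n f g t : bern n (fun j => f j + g j) t = bern n f t + bern n g t.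
Proof. by elim: n f g => [//|n IH] f g /=; rewrite /comp !IH; ring. Qed.

Lemma bernZ n a f t : bern n (fun j => a * f j) t = a * bern n f t.
Proof. by elim: n f => [//|n IH] f /=; rewrite /comp !IH; ring. Qed.

Lemma bern_cst n c t : bern n (fun=> c) t = c.
Proof. by elim: n => [//|n IH] /=; rewrite /comp !IH; ring. Qed.

Lemma le_bern n f g t : 0 <= t <= 1 -> (forall j, f j <= g j) ->
  bern n f t <= bern n g t.
Proof.
move=> tI; elim: n f g => [|n IH] f g fg /=; first exact: fg.
by apply: lerD; apply: ler_wpM2l; [lra|apply: IH => j; exact: fg|lra|exact: IH].
Qed.

(** Variance plus squared bias. The centre [s] stays arbitrary because the shift by [S] in the
    recursion replaces it by [s - 1]. *)
Lemma bern_variance n s t :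
  bern n (fun j => (j%:R - s) ^+ 2) t = n%:R * (t * (1 - t)) + (n%:R * t - s) ^+ 2.
Proof.
elim: n s => [|n IH] s /=; first by ring.
have E : (fun j => (j%:R - s) ^+ 2) \o S = (fun j => (j%:R - (s - 1)) ^+ 2).
  by apply/funext => j /=; rewrite -natr1; ring.
by rewrite E !IH -natr1; ring.
Qed.

(** Chebyshev's argument at a single point: [phi] differs from [phi t] by at most a small constant
    plus a multiple of [(s - t)^2], and the mean of the latter is of order [1 / n]. The index [n.+1]
    avoids division by zero. *)
Lemma bern_cvg (phi : R -> R) (M t : R) : 0 <= t <= 1 ->
  (forall s, `|phi s| <= M) -> {for t, continuous phi} ->
  bern n.+1 (fun j => phi (j%:R / n.+1%:R)) t @[n --> \oo] --> phi t.
Proof.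
move=> tI phiM cphi; apply/cvgrPdist_le; change (forall e : R, 0 < e -> \forall n \near \oo,
  `|phi t - bern n.+1 (fun j => phi (j%:R / n.+1%:R)) t| <= e) => e e0.
have e20 : 0 < e / 2 by lra.
have /cvgrPdist_le/(_ _ e20) := cphi.
case=> d /= d0 Hd.
have M0 : 0 <= M by exact: le_trans (normr_ge0 _) (phiM 0).
(* With this [K] the quadratic term alone dominates the crude bound [2 M] as soon as [s] is at
   distance at least [d] from [t]. *)
pose K := 2 * M / d ^+ 2.
have K0 : 0 <= K by rewrite /K divr_ge0 ?mulr_ge0 ?exprn_ge0 //; lra.
have key s : `|phi s - phi t| <= e / 2 + K * (s - t) ^+ 2.
  have [st|st] := ltP `|t - s| d.
    have := Hd s st; rewrite distrC => H.
    by apply: (le_trans H); rewrite lerDl mulr_ge0// sqr_ge0.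
  have H : `|phi s - phi t| <= 2 * M.
    apply: (le_trans (ler_normB _ _)).
    by have := phiM s; have := phiM t; lra.
  apply: (le_trans H); apply: (@le_trans _ _ (K * (s - t) ^+ 2)); last lra.
  rewrite /K mulrAC ler_pdivlMr ?exprn_gt0// ler_wpM2l ?mulr_ge0//.
  rewrite -(real_normK (num_real (s - t))) distrC.
  have := normr_ge0 (t - s); nra.
clearbody K.
have /cvgrPdist_le/(_ _ e20) : (K * n.+1%:R^-1 : R) @[n --> \oo] --> (0 : R).
  by rewrite -[X in _ --> X](mulr0 K); apply: cvgMr; exact: cvg_harmonic.
apply: filterS => n; rewrite sub0r normrN ger0_norm ?mulr_ge0// => Hn.
have n0 : (0 : R) < n.+1%:R by rewrite ltr0n.
(* The bias vanishes at the centre [(n + 1) t], so only the variance [t (1 - t) / (n + 1)]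
   remains. *)
have bnd : bern n.+1 (fun j => e / 2 + K * (j%:R / n.+1%:R - t) ^+ 2) t <= e.
  rewrite bernD bern_cst bernZ.
  have -> : (fun j : nat => (j%:R / n.+1%:R - t) ^+ 2) =
      (fun j => (n.+1%:R ^- 2) * (j%:R - n.+1%:R * t) ^+ 2).
    apply/funext => j; rewrite -exprVn -exprMn; congr (_ ^+ 2).
    by field; rewrite gt_eqF.
  rewrite bernZ bern_variance subrr expr0n/= addr0 expr2.
  have -> : K * ((n.+1%:R * n.+1%:R)^-1 * (n.+1%:R * (t * (1 - t)))) =
      (K * n.+1%:R^-1) * (t * (1 - t)).
    by field; rewrite gt_eqF.
  have X0 : 0 <= K * n.+1%:R^-1 by rewrite mulr_ge0// invr_ge0 ltW.
  have t1 : t * (1 - t) <= 1 by nra.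
  have Hn' : (K / n.+1%:R : R) <= e / 2 by exact: Hn.
  have h : (K / n.+1%:R : R) * (t * (1 - t)) <= K / n.+1%:R.
    by have := ler_wpM2l X0 t1; rewrite mulr1.
  by apply: (@le_trans _ _ (e / 2 + e / 2)); [rewrite lerD2l (le_trans h)|rewrite -splitr].
have E c : bern n.+1 (fun j => phi (j%:R / n.+1%:R)) t - c =
    bern n.+1 (fun j => phi (j%:R / n.+1%:R) + (- c)) t.
  by rewrite bernD bern_cst.
have E' c : c - bern n.+1 (fun j => phi (j%:R / n.+1%:R)) t =
    bern n.+1 (fun j => c + (-1) * phi (j%:R / n.+1%:R)) t.
  by rewrite bernD bern_cst bernZ mulN1r.
rewrite ler_norml; apply/andP; split; last first.
  rewrite E'; apply: le_trans bnd; apply: le_bern => // j.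
  by rewrite mulN1r; apply: le_trans (key _); rewrite -normrN opprB ler_norm.
rewrite lerNl opprB E; apply: le_trans bnd; apply: le_bern => // j.
by apply: le_trans (key _); rewrite ler_norm.
Qed.

End Bernstein.

(** * Approximation in the mean by even cosine polynomials *)

Section EvenTrig.
Context {R : realType}.
Notation mu := (@lebesgue_measure R).
Implicit Types (f g h u : R -> R).

(** The linear span of the [nb m.*2], which up to sign and normalization are the functions
    [cos (m pi x)]. The inductive form gives linear arguments by induction. *)
Inductive even_trig : (R -> R) -> Prop :=
| even_trig_nb m : even_trig (nb m.*2)
| even_trigD f g : even_trig f -> even_trig g -> even_trig (fun x => f x + g x)
| even_trigZ a f : even_trig f -> even_trig (fun x => a * f x).

Lemma sq_integrable_even_trig f : even_trig f -> sq_integrable f.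
Proof.
elim=> [m|? ? _ ? _ ?|? ? _ ?]; first exact: sq_integrable_nb.
  exact: sq_integrableD.
exact: sq_integrableZ.
Qed.

Lemma cosDnatpi (a : R) m : cos (a + m%:R * pi) = (-1) ^+ m * cos a.
Proof.
elim: m => [|m IH]; first by rewrite mul0r addr0 expr0 mul1r.
by rewrite -natr1 mulrDl mul1r addrA cosDpi IH exprS; ring.
Qed.

Lemma nb_double m x : (0 < m)%N -> nb m.*2 x = (-1) ^+ m * cos (m%:R * pi * x) :> R.
Proof.
move=> m0; rewrite /nb double_eq0 gtn_eqF// -cosDnatpi; congr cos.
by rewrite -muln2 natrM; field.
Qed.

Lemma even_trig_cos m : even_trig (fun x => cos (m%:R * pi * x)).
Proof.
case: m => [|m].
  have := even_trigZ (Num.sqrt 2) (even_trig_nb 0); congr even_trig.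
  by apply/funext => x; rewrite /nb/= mulfV ?sqrt2_neq0// !mul0r cos0.
have := even_trigZ ((-1) ^+ m.+1) (even_trig_nb m.+1); congr even_trig.
by apply/funext => x; rewrite nb_double// mulrA -exprMn mulrNN mulr1 expr1n mul1r.
Qed.

(** By product-to-sum, multiplication by [cos (pi x)] moves a frequency [m] to [m - 1] and [m + 1];
    the constant is treated apart. Hence the span contains all polynomials in [cos (pi x)]. *)
Lemma even_trigMcos f : even_trig f -> even_trig (fun x => cos (pi * x) * f x).
Proof.
elim=> [[|m]|g h _ IHg _ IHh|a g _ IHg].
- have := even_trigZ (Num.sqrt 2)^-1 (even_trig_cos 1); congr even_trig.
  by apply/funext => x; rewrite /nb/= mul1r mulrC.
- have := even_trigZ ((-1) ^+ m.+1 / 2)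
    (even_trigD (even_trig_cos m) (even_trig_cos m.+2)); congr even_trig.
  apply/funext => x; rewrite nb_double// mulrCA (mulrC (cos (pi * x))) cosMcos.
  have -> : m%:R * pi * x = m.+1%:R * pi * x - pi * x by rewrite -natr1; ring.
  have -> : m.+2%:R * pi * x = m.+1%:R * pi * x + pi * x by rewrite -natr1; ring.
  by rewrite mulrA.
- by have := even_trigD IHg IHh; congr even_trig; apply/funext => x; ring.
- by have := even_trigZ a IHg; congr even_trig; apply/funext => x; ring.
Qed.

(** With [t = (1 + cos (pi x)) / 2], one step of the recursion of [bern] only adds, scales and
    multiplies by [cos (pi x)]. *)
Lemma even_trig_bern n (f : nat -> R) :
  even_trig (fun x => bern n f ((1 + cos (pi * x)) / 2)).
Proof.
elim: n f => [|n IH] f /=.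
  have := even_trigZ (f 0%N) (even_trig_cos 0); congr even_trig.
  by apply/funext => x; rewrite !mul0r cos0 mulr1.
have A := IH (f \o S); have B := IH f.
have := even_trigZ 2^-1 (even_trigD (even_trigD A (even_trigMcos A))
  (even_trigD B (even_trigZ (-1) (even_trigMcos B)))); congr even_trig.
by apply/funext => x; field.
Qed.

(** The point 0 is exempted for the sake of [even_approx], where [acos] is evaluated at the end of
    its domain for [z = 0]. *)
Lemma ip_dominated (F : nat -> R -> R) h :
  (forall n, sq_integrable (F n)) -> mu.-integrable itv11 (EFin \o h) ->
  (forall n z, itv11 z -> F n z ^+ 2 <= h z) ->
  (forall z, itv11 z -> z != 0 -> F n z @[n --> \oo] --> 0) ->
  forall e, 0 < e -> exists n, ip (F n) (F n) <= e.
Proof.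
move=> LF ih Fh F0 e e0.
have [] := @dominated_convergence _ _ _ mu itv11 measurable_itv11
  (fun n x => (F n x * F n x)%:E) (cst 0%E) (EFin \o h) _ _ _ ih _.
- by move=> n; case/integrableP: (sq_integrableM (LF n) (LF n)).
- exact: measurable_cst.
- exists [set 0]; split; [exact: measurable_set1|exact: lebesgue_measure_set1|].
  move=> z /= H; apply: contrapT => /eqP z0; apply: H => zI.
  apply: cvg_EFin; first exact: nearW.
  by rewrite -[X in _ --> X](mulr0 0); apply: cvgM; exact: F0.
- apply: aeW => z n zI /=; rewrite lee_fin ger0_norm -expr2 ?sqr_ge0//.
  exact: Fh.
move=> _ _; rewrite integral0 => /fine_cvgP[_ /cvgrPdist_le/(_ _ e0)[N _ /(_ N (leqnn N))]].
by rewrite /= sub0r normrN => /(le_trans (ler_norm _)) H; exists N.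
Qed.

Lemma even_approx g M : continuous g -> (forall x, `|g x| <= M) ->
  forall e, 0 < e -> exists2 p, even_trig p &
    ip (fun z => g `|z| - p z) (fun z => g `|z| - p z) <= e.
Proof.
move=> cg gM e e0.
(* [phi] is [g] read in the variable [t = (1 + cos (pi z)) / 2], which determines [|z|] on
   [[-1, 1]]. *)
pose phi t := g (acos (2 * t - 1) / pi).
pose p n z := bern n.+1 (fun j => phi (j%:R / n.+1%:R)) ((1 + cos (pi * z)) / 2).
have tI z : 0 <= (1 + cos (pi * z)) / 2 <= 1.
  by have := cos_geN1 (pi * z); have := cos_le1 (pi * z); lra.
have pM n z : `|p n z| <= M.
  rewrite ler_norml; apply/andP; split.
    rewrite -(bern_cst n.+1 (- M) ((1 + cos (pi * z)) / 2)); apply: le_bern => // j.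
    by have := gM (acos (2 * (j%:R / n.+1%:R) - 1) / pi); rewrite ler_norml => /andP[].
  rewrite -[leRHS](bern_cst n.+1 M ((1 + cos (pi * z)) / 2)); apply: le_bern => // j.
  by have := gM (acos (2 * (j%:R / n.+1%:R) - 1) / pi); rewrite ler_norml => /andP[].
have Lp n : sq_integrable (p n) by apply: sq_integrable_even_trig; exact: even_trig_bern.
have Lg : sq_integrable (fun z => g `|z|).
  apply: (@sq_integrable_bounded _ M) => //.
  apply: (measurableT_comp (continuous_measurable_fun cg)); exact: normr_measurable.
have [] := @ip_dominated (fun n z => g `|z| - p n z) (cst ((2 * M) ^+ 2)) _ _ _ _ e e0.
- by move=> n; exact: sq_integrableB.
- have := sq_integrableM (sq_integrable_cst 1) (sq_integrable_cst ((2 * M) ^+ 2)).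
  by apply: eq_integrable => // x _; rewrite /= mul1r.
- move=> n z _ /=; rewrite -(real_normK (num_real (_ - _))).
  have H : `|g `|z| - p n z| <= 2 * M.
    apply: (le_trans (ler_normB _ _)).
    by have := gM `|z|; have := pM n z; lra.
  by have := normr_ge0 (g `|z| - p n z); nra.
- move=> z; rewrite /itv11/= in_itv/= => zI z0.
  have pi0 := pi_gt0 R.
  have a0 : 0 < `|z| by rewrite normr_gt0.
  have a1 : `|z| < 1 by rewrite ltr_norml; lra.
  have p0 : 0 < pi * `|z| by rewrite mulr_gt0.
  have p1 : pi * `|z| < pi by rewrite gtr_pMr.
  have cosz : cos (pi * z) = cos (pi * `|z|).
    by have [_|_] := ger0P z; rewrite ?mulrN ?cosN.
  have ac : acos (cos (pi * z)) = pi * `|z|.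
    by rewrite cosz cosK// in_itv/= !ltW.
  have phiE : phi ((1 + cos (pi * z)) / 2) = g `|z|.
    rewrite /phi (_ : 2 * _ - 1 = cos (pi * z)); last by field.
    by rewrite ac; congr g; rewrite mulrC mulKf ?gt_eqF.
  (* Strict bounds are what continuity of [acos] needs; they hold because [0 < |z| < 1]. *)
  rewrite -phiE; have cI : -1 < cos (pi * z) < 1.
    rewrite cosz; apply/andP; split.
      by rewrite -cospi ltr_cos ?in_itv/= ?lexx ?ltW.
    by rewrite -[ltRHS]cos0 ltr_cos ?in_itv/= ?lexx ?ltW.
  rewrite -[X in _ --> X](subrr (phi ((1 + cos (pi * z)) / 2))).
  apply: cvgB; first exact: cvg_cst.
  apply: (@bern_cvg _ phi M) => //; first by move=> s; exact: gM.
  apply: (continuous_comp (f := fun t : R => acos (2 * t - 1) / pi)); last exact: cg.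
  apply: continuousM; last exact: cvg_cst.
  apply: (continuous_comp (f := fun t : R => 2 * t - 1)).
    by apply: continuousB; [apply: continuousM; [exact: cvg_cst|exact: cvg_id]|exact: cvg_cst].
  by apply: continuous_acos; lra.
by move=> n Hn; exists (p n) => //; exact: even_trig_bern.
Qed.

Definition clamp (N x : R) : R := Num.max (- N) (Num.min N x).

Lemma clamp_le N x : 0 <= N -> `|clamp N x| <= N.
Proof.
move=> N0; rewrite /clamp ler_norml le_max lexx/= ge_max ge_min lexx/=; lra.
Qed.

Lemma clampE N x : `|x| <= N -> clamp N x = x.
Proof.
by rewrite ler_norml /clamp => /andP[h1 h2]; rewrite min_r// max_r.
Qed.

Lemma dist_clamp N x y : `|clamp N x - clamp N y| <= `|x - y|.
Proof.
rewrite /clamp /Num.max /Num.min.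
have := ler_norm (x - y); have := ler_norm (y - x); rewrite distrC => h1 h2.
by rewrite ler_norml; repeat case: ifPn; rewrite -?leNgt; lra.
Qed.

Lemma continuous_clamp N : continuous (clamp N).
Proof.
move=> x; apply/cvgrPdist_le => e e0; near=> y.
apply: le_trans (dist_clamp _ _ _) _.
near: y; exact: cvgr_dist_le.
Unshelve. all: by end_near. Qed.

(** One factor of the square is bounded by [2 N], the other by [|x - y|]. This turns smallness in
    L^1 into smallness in L^2. *)
Lemma sq_dist_clamp N x y : 0 <= N ->
  (clamp N x - clamp N y) ^+ 2 <= 2 * N * `|x - y|.
Proof.
move=> N0; have h1 := dist_clamp N x y.
have h2 : `|clamp N x - clamp N y| <= 2 * N.
  by apply: (le_trans (ler_normB _ _)); have := clamp_le x N0; have := clamp_le y N0; lra.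
rewrite -(real_normK (num_real (_ - _))).
have := normr_ge0 (clamp N x - clamp N y); nra.
Qed.

(** The error is at most [|f|], so [f^2] dominates its square, and at each point it is zero once [n]
    exceeds [|f z|]. *)
Lemma clamp_approx f : sq_integrable f -> forall e, 0 < e -> exists n : nat,
  ip (fun z => f z - clamp n%:R (f z)) (fun z => f z - clamp n%:R (f z)) <= e.
Proof.
move=> Lf e e0.
have Lc n : sq_integrable (fun z => clamp n%:R (f z)).
  apply: (@sq_integrable_bounded _ n%:R); last by move=> x; exact: clamp_le.
  apply: (measurableT_comp (continuous_measurable_fun (@continuous_clamp n%:R))).
  by case: Lf.
apply: (@ip_dominated (fun n z => f z - clamp n%:R (f z)) (fun z => f z ^+ 2)) => //.
- by move=> n; exact: sq_integrableB.
- by case: Lf.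
- move=> n z _; rewrite -(real_normK (num_real (_ - _))) -(real_normK (num_real (f z))).
  have E0 : clamp n%:R 0 = 0 :> R by rewrite clampE// normr0.
  suff : `|f z - clamp n%:R (f z)| <= `|f z| by have := normr_ge0 (f z - clamp n%:R (f z)); nra.
  have n0 : (0 : R) <= n%:R by [].
  rewrite /clamp /Num.max /Num.min.
  by have [f0|f0] := ger0P (f z); rewrite ler_norml; repeat case: ifPn; rewrite -?leNgt; lra.
- move=> z _ _; apply: cvg_near_cst.
  exists (Num.truncn `|f z|).+1 => // n /= Hn.
  rewrite clampE ?subrr//; apply: le_trans (ltW (truncnS_gt _)) _.
  by rewrite ler_nat.
Qed.

(** First truncate [f], then approximate the truncation in L^1 by a continuous function, and
    truncate that one too, so that [sq_dist_clamp] applies. *)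
Lemma continuous_approx f : sq_integrable f -> forall e, 0 < e ->
  exists g M, [/\ continuous g, forall x, `|g x| <= M, sq_integrable g &
    ip (fun z => f z - g z) (fun z => f z - g z) <= e].
Proof.
move=> Lf e e0.
(* Since [(a + b)^2 <= 2 a^2 + 2 b^2], two errors of [e / 4] add up to [e]. *)
have [||n Hn] := @clamp_approx f _ (e / 4) => //; first by lra.
set N : R := n%:R in Hn.
have N0 : 0 <= N by [].
pose fN z := clamp N (f z).
have LfN : sq_integrable fN.
  apply: (@sq_integrable_bounded _ N); last by move=> x; exact: clamp_le.
  apply: (measurableT_comp (continuous_measurable_fun (@continuous_clamp N))).
  by case: Lf.
have IfN : mu.-integrable itv11 (EFin \o fN).
  have := sq_integrableM (sq_integrable_cst 1) LfN.
  by apply: eq_integrable => // x _; rewrite /= mul1r.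
have [] := @approximation_continuous_integrable R itv11 fN measurable_itv11 _ IfN.
  by apply: (@eq_ind_r _ 2%:E (fun z => (z < +oo)%E)); [exact: ltry|exact: mu_itv11].
move=> g [cg Ig /fine_cvgP[_ /cvgrPdist_le]].
(* Multiplied by [2 N] this is at most [e / 4]; the added 1 covers [N = 0]. *)
have d0 : 0 < e / (8 * N + 1) by rewrite divr_gt0//; lra.
move=> /(_ _ d0)[m _ /(_ m (leqnn m))] /=.
rewrite sub0r normrN => /(le_trans (ler_norm _)) Hm.
pose h z := clamp N (g m z).
have ch : continuous h.
  by move=> z; apply: (continuous_comp (f := g m)); [exact: cg|exact: continuous_clamp].
have hN z : `|h z| <= N by exact: clamp_le.
have Lh : sq_integrable h.
  by apply: (@sq_integrable_bounded _ N) => //; exact: continuous_measurable_fun.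
exists h, N; split => //.
have L1 : sq_integrable (fun z => f z - fN z) by exact: sq_integrableB.
have L2 : sq_integrable (fun z => fN z - h z) by exact: sq_integrableB.
have L12 : sq_integrable (fun z => f z - h z) by exact: sq_integrableB.
have I2 : mu.-integrable itv11 (EFin \o (fun z => `|fN z - g m z|)).
  have := integrable_abse (integrableB measurable_itv11 IfN (Ig m)).
  by apply: eq_integrable.
have H2 : ip (fun z => fN z - h z) (fun z => fN z - h z) <= e / 4.
  apply: (@le_trans _ _ (2 * N * \int[mu]_(z in itv11) `|fN z - g m z|)).
    rewrite -RintegralZl//; apply: le_Rintegral => //.
    - exact: sq_integrableM.
    - by have := integrableZl measurable_itv11 (2 * N) I2; exact: eq_integrable.
    move=> z _; rewrite -expr2.
    by have := sq_dist_clamp (fN z) (g m z) N0; rewrite (clampE (clamp_le (f z) N0)).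
  have A : \int[mu]_(z in itv11) `|fN z - g m z| <= e / (8 * N + 1) by [].
  move: A; rewrite ler_pdivlMr; last lra.
  by have : 0 <= \int[mu]_(z in itv11) `|fN z - g m z| by [exact: Rintegral_ge0]; nra.
have E : ip (fun z => f z - h z) (fun z => f z - h z) <=
    2 * ip (fun z => f z - fN z) (fun z => f z - fN z) +
    2 * ip (fun z => fN z - h z) (fun z => fN z - h z).
  have Z1 := sq_integrableZ 2 L1; have Z2 := sq_integrableZ 2 L2.
  rewrite -!ipZl// /ip -RintegralD//; [|exact: sq_integrableM..].
  apply: le_Rintegral => //; first exact: sq_integrableM.
    have := integrableD measurable_itv11 (sq_integrableM Z1 L1) (sq_integrableM Z2 L2).
    exact: eq_integrable.
  move=> z _; have := sqr_ge0 ((f z - fN z) - (fN z - h z)); nra.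
apply: (le_trans E); move: Hn H2; rewrite -/fN; lra.
Qed.

End EvenTrig.

(** * The convolution formula for real functions *)

Section NeumannConvolution.
Context {R : realType}.
Notation mu := (@lebesgue_measure R).
Implicit Types (f g h u C : R -> R).

Lemma even_density C : sq_integrable C ->
  (fun x => C (- x)) = C %[ae mu in itv11] ->
  forall e, 0 < e -> exists2 p, even_trig p &
    ip (fun z => C z - p z) (fun z => C z - p z) <= e.
Proof.
move=> LC Cev e e0.
have LCa := sq_integrable_fold fold_abs LC.
have aeC : (fun x => C `|x|) = C %[ae mu in itv11].
  apply: ae_eq_itv11S Cev => x _ H.
  by have [//|_] := ger0P x; exact: H.
(* Replacing [z] by [|z|] may double the squared error, so [e / 8] becomes [e / 4]; with the [e / 4]
   of [even_approx], the factors 2 of the squared sum give [e]. *)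
have e8 : 0 < e / 8 by lra.
have [g [M [cg gM Lg Hg]]] := continuous_approx LC e8.
have e4 : 0 < e / 4 by lra.
have [p etp Hp] := even_approx cg gM e4.
exists p => //.
have Lp := sq_integrable_even_trig etp.
have Lga := sq_integrable_fold fold_abs Lg.
have L1 := sq_integrableB LCa Lga.
have L2 := sq_integrableB Lga Lp.
have L12 := sq_integrableB LCa Lp.
have Lo := sq_integrableB LC Lp.
have aeCp : (fun z => C z - p z) = (fun z => C `|z| - p z) %[ae mu in itv11].
  by apply: ae_eq_itv11S aeC => x _ <-.
have H1 := ip_fold_le fold_abs (sq_integrableB LC Lg).
rewrite (ae_eq_ipl Lo L12 Lo aeCp) ipC (ae_eq_ipl Lo L12 L12 aeCp).
have Z1 := sq_integrableZ 2 L1; have Z2 := sq_integrableZ 2 L2.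
apply: (@le_trans _ _ (2 * ip (fun z => C `|z| - g `|z|) (fun z => C `|z| - g `|z|) +
    2 * ip (fun z => g `|z| - p z) (fun z => g `|z| - p z))); last by lra.
rewrite -!ipZl// /ip -RintegralD//; [|exact: sq_integrableM..].
apply: le_Rintegral => //; first exact: sq_integrableM.
  have := integrableD measurable_itv11 (sq_integrableM Z1 L1) (sq_integrableM Z2 L2).
  exact: eq_integrable.
move=> z _; have := sqr_ge0 ((C `|z| - g `|z|) - (g `|z| - p z)); nra.
Qed.

(** This is [C_1 - C_2], the only combination of the two that enters the four integrals. *)
Definition fold1 C (z : R) : R := C (1 - `|z|).

(* [kappa C] and [per_conv x C u] are the constant and the convolution part of
   the formula after the substitution [C_1 - C_2 = fold1 C]. *)
Definition kappa C : R :=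
  Num.sqrt 2 / 2 * ip (nb 0) (fun z => C `|z|) - ip (nb 0) (fold1 C).

Definition per_conv (x : R) C u : R :=
  2^-1 * ip (fun y => fold1 C (red (x - y))) u +
  2^-1 * ip (fun y => fold1 C (red (- x - y))) u.

Definition nterm (x : R) C u k : R := ip (nb k) C * ip (nb k) u * nb k x.

(** Only a finite partial sum occurs, so that linearity and bounds need no prior convergence of the
    series. *)
Definition defect n (x : R) C u : R :=
  per_conv x C u + kappa C * ip (nb 0) u - \sum_(0 <= k < n) nterm x C u k.

Lemma itv11N (x : R) : itv11 x -> itv11 (- x).
Proof. by rewrite /itv11/= !in_itv/=; lra. Qed.

Lemma sq_integrable_fold1 C : sq_integrable C -> sq_integrable (fold1 C).
Proof. exact: sq_integrable_fold fold_1subabs. Qed.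

Lemma sq_integrable_red x f : itv11 x -> sq_integrable f ->
  sq_integrable (fun y => f (red (x - y))).
Proof. by move=> xI; exact: (sq_integrable_fold (fold_red xI)). Qed.

Lemma defectD n x f g u : itv11 x -> sq_integrable f -> sq_integrable g ->
  sq_integrable u ->
  defect n x (fun z => f z + g z) u = defect n x f u + defect n x g u.
Proof.
move=> xI Lf Lg Lu; rewrite /defect /per_conv /kappa /fold1.
have Lf1 := sq_integrable_fold1 Lf; have Lg1 := sq_integrable_fold1 Lg.
have L0 : sq_integrable (nb 0) := sq_integrable_nb 0.
rewrite !(ipDl, ipDr)//; try exact: (sq_integrable_red _ Lf1);
  try exact: (sq_integrable_red _ Lg1);
  try exact: (sq_integrable_red (itv11N _) Lf1);
  try exact: (sq_integrable_red (itv11N _) Lg1);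
  try exact: (sq_integrable_fold fold_abs).
have -> : \sum_(0 <= k < n) nterm x (fun z => f z + g z) u k =
    \sum_(0 <= k < n) nterm x f u k + \sum_(0 <= k < n) nterm x g u k.
  rewrite -big_split/=; apply: eq_bigr => k _; rewrite /nterm ipDr//.
    by ring.
  exact: sq_integrable_nb.
ring.
Qed.

Lemma defectZ n x a f u : itv11 x -> sq_integrable f -> sq_integrable u ->
  defect n x (fun z => a * f z) u = a * defect n x f u.
Proof.
move=> xI Lf Lu; rewrite /defect /per_conv /kappa /fold1.
have Lf1 := sq_integrable_fold1 Lf.
have L0 : sq_integrable (nb 0) := sq_integrable_nb 0.
rewrite !(ipZl, ipZr)//; try exact: (sq_integrable_red _ Lf1);
  try exact: (sq_integrable_red (itv11N _) Lf1);
  try exact: (sq_integrable_fold fold_abs).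
have -> : \sum_(0 <= k < n) nterm x (fun z => a * f z) u k =
    a * \sum_(0 <= k < n) nterm x f u k.
  rewrite big_distrr/=; apply: eq_bigr => k _; rewrite /nterm ipZr//.
    by ring.
  exact: sq_integrable_nb.
ring.
Qed.

Lemma amgm (a b t : R) : 0 < t -> `|a * b| <= t * a ^+ 2 + b ^+ 2 / t.
Proof.
move=> t0; rewrite normrM -[a ^+ 2]real_normK ?num_real// -[b ^+ 2]real_normK ?num_real//.
have -> : t * `|a| ^+ 2 + `|b| ^+ 2 / t = 2 * `|a| * `|b| + t * (`|a| - `|b| / t) ^+ 2.
  by field; rewrite gt_eqF.
have h1 : 0 <= t * (`|a| - `|b| / t) ^+ 2 by rewrite mulr_ge0 ?sqr_ge0// ltW.
have h2 : 0 <= `|a| * `|b| by rewrite mulr_ge0.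
lra.
Qed.

Lemma le_norm_sum_nterm n x f u t : 0 < t -> sq_integrable f -> sq_integrable u ->
  \sum_(0 <= k < n) `|nterm x f u k| <= t * ip f f + ip u u / t.
Proof.
move=> t0 Lf Lu.
apply: (@le_trans _ _ (\sum_(0 <= k < n) (t * ip (nb k) f ^+ 2 + ip (nb k) u ^+ 2 / t))).
  apply: ler_sum => k _; rewrite /nterm normrM.
  apply: (@le_trans _ _ (`|ip (nb k) f * ip (nb k) u| * 1)).
    by apply: ler_wpM2l => //; exact: nb_le1.
  by rewrite mulr1; exact: amgm.
rewrite big_split/= -big_distrr -big_distrl/=.
by apply: lerD; [apply: ler_wpM2l; [exact: ltW|exact: bessel]|
  apply: ler_wpM2r; [rewrite invr_ge0 ltW|exact: bessel]].
Qed.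

Lemma ip_nb0_sq f : sq_integrable f -> ip (nb 0) f ^+ 2 <= ip f f.
Proof. by move=> Lf; have := bessel 1 Lf; rewrite big_nat1. Qed.

(** The constant 13 is 6 + 6 + 1: the integrals give [3 * 2] from the two nested foldings, [kappa]
    gives 6, the partial sum 1. Each of these three adds one [ip u u / t]. *)
Lemma defect_le n x f u t : itv11 x -> 0 < t -> sq_integrable f -> sq_integrable u ->
  `|defect n x f u| <= 13 * (t * ip f f) + 3 * (ip u u / t).
Proof.
move=> xI t0 Lf Lu; rewrite /defect.
have Lf1 := sq_integrable_fold1 Lf.
have N1 : ip (fold1 f) (fold1 f) <= 2 * ip f f := ip_fold_le fold_1subabs Lf.
have N0 : ip (fun z => f `|z|) (fun z => f `|z|) <= 2 * ip f f := ip_fold_le fold_abs Lf.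
have half s : itv11 s -> `|ip (fun y => fold1 f (red (s - y))) u| <=
    6 * (t * ip f f) + ip u u / t.
  move=> sI; apply: (le_trans (ip_amgm t0 (sq_integrable_red sI Lf1) Lu)).
  rewrite lerD2r [leRHS]mulrCA; apply: ler_wpM2l; first exact: ltW.
  have := ip_fold_le (fold_red sI) Lf1; lra.
have h1 := half x xI; have h2 := half (- x) (itv11N xI).
have h3 := le_norm_sum_nterm n x t0 Lf Lu.
have h4 : `|kappa f * ip (nb 0) u| <= 6 * (t * ip f f) + ip u u / t.
  apply: (le_trans (amgm _ _ t0)); apply: lerD; last first.
    by apply: ler_wpM2r; [rewrite invr_ge0 ltW|exact: ip_nb0_sq].
  rewrite [leRHS]mulrCA; apply: ler_wpM2l; first exact: ltW.
  have b1 : ip (nb 0) (fun z => f `|z|) ^+ 2 <= _ := ip_nb0_sq (sq_integrable_fold fold_abs Lf).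
  have b2 : ip (nb 0) (fold1 f) ^+ 2 <= _ := ip_nb0_sq Lf1.
  rewrite /kappa; set A := ip _ _ in b1 *; set B := ip _ _ in b2 *.
  (* This is [(p - q)^2 = 2 p^2 + 2 q^2 - (p + q)^2]; with [A^2] and [B^2] at most [2 * ip f f], the
     total is at most 6. *)
  have -> : (Num.sqrt 2 / 2 * A - B) ^+ 2 = A ^+ 2 + 2 * B ^+ 2 - (Num.sqrt 2 / 2 * A + B) ^+ 2.
    have -> : A ^+ 2 = 2 * (Num.sqrt 2 * Num.sqrt 2 / 4) * A ^+ 2 by rewrite sqrt2_sq; field.
    by field.
  have := sqr_ge0 (Num.sqrt 2 / 2 * A + B).
  lra.
have h5 : `|\sum_(0 <= k < n) nterm x f u k| <= t * ip f f + ip u u / t.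
  by apply: le_trans h3; exact: ler_norm_sum.
rewrite /per_conv; move: h1 h2 h4 h5.
rewrite !ler_norml => /andP[? ?] /andP[? ?] /andP[? ?] /andP[? ?].
by apply/andP; split; lra.
Qed.

(** [red] shifts by an even integer, hence the argument by a multiple of [2 pi]. The two signs of
    the floor are treated separately. *)
Lemma cos_pi_red (m : nat) z : cos (m%:R * pi * red z) = cos (m%:R * pi * z) :> R.
Proof.
have H (a : R) (k : nat) : cos (a + m%:R * (k%:R * 2) * pi) = cos a.
  by rewrite -!natrM cosDnatpi mulnA muln2 -signr_odd odd_double expr0 mul1r.
rewrite /red; case: (Num.floor _) => k.
  rewrite -(H _ k); congr cos; rewrite -pmulrn; ring.
by rewrite NegzE -[RHS](H _ k.+1); congr cos; rewrite mulrNz -pmulrn; ring.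
Qed.

(** For [m > 0], [kappa] vanishes by orthogonality and [cos (a - b) + cos (a + b) = 2 cos a cos b]
    separates [x] from [y]. For [m = 0] the integrals give the coefficient 1 instead of
    [sqrt 2 / 2], and [kappa] corrects exactly this. *)
Lemma defect_nb m n x u : itv11 x -> sq_integrable u -> (m.*2 < n)%N ->
  defect n x (nb m.*2) u = 0.
Proof.
move=> xI Lu mn; rewrite /defect.
have L0 : sq_integrable (nb 0 : R -> R) := sq_integrable_nb 0.
have -> : \sum_(0 <= k < n) nterm x (nb m.*2) u k = ip (nb m.*2) u * nb m.*2 x.
  rewrite (bigD1_seq m.*2)/= ?mem_index_iota ?iota_uniq//.
  rewrite big1 ?addr0; last first.
    by move=> k km; rewrite /nterm ip_nb (negbTE km) !mul0r.
  by rewrite /nterm ip_nb eqxx mul1r.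
case: m mn => [|m] mn.
  (* [nb 0] is constant, so the foldings do not affect it. *)
  have E0 : ip (nb 0) (fun z => nb 0 `|z|) = 1 :> R by exact: (ip_nb 0 0).
  have E1 : ip (nb 0) (fold1 (nb 0)) = 1 :> R by exact: (ip_nb 0 0).
  have E2 s : ip (fun y => fold1 (nb 0) (red (s - y))) u = ip (nb 0) u by [].
  rewrite /per_conv /kappa !E2 E0 ?E1.
  have -> : nb 0 x = Num.sqrt 2 / 2.
    by rewrite /nb/= -[X in _ / X]sqrt2_sq invfM mulrA mulfV ?mul1r// sqrt2_neq0.
  by field.
set q := m.+1 in mn *.
have s2 : (-1) ^+ q * (-1) ^+ q = 1 :> R by rewrite -exprMn mulrNN mulr1 expr1n.
have Ea : (fun z => nb q.*2 `|z|) = nb q.*2 :> (R -> R).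
  apply/funext => z; rewrite !nb_double//; congr (_ * _).
  by have [_|_] := ger0P z; rewrite ?mulrN ?cosN.
have Eu : fold1 (nb q.*2) = (fun z => cos (q%:R * pi * z)) :> (R -> R).
  apply/funext => z; rewrite /fold1 nb_double// mulrBr mulr1.
  have -> : q%:R * pi - q%:R * pi * `|z| = - (q%:R * pi * `|z|) + q%:R * pi by ring.
  rewrite cosDnatpi mulrA s2 mul1r cosN.
  by have [_|_] := ger0P z; rewrite ?mulrN ?cosN.
have Eu' : fold1 (nb q.*2) = (fun z => (-1) ^+ q * nb q.*2 z) :> (R -> R).
  by rewrite Eu; apply/funext => z; rewrite nb_double// mulrA s2 mul1r.
have -> : kappa (nb q.*2) = 0.
  rewrite /kappa Ea Eu' ipZr//; last exact: sq_integrable_nb.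
  by rewrite ip_nb !mulr0 subr0.
rewrite mul0r addr0 /per_conv Eu.
have LC s : sq_integrable (fun y : R => cos (q%:R * pi * red (s - y))).
  under eq_fun do rewrite cos_pi_red.
  have := sq_integrable_cos_affine (- (q%:R * pi)) (- s).
  by congr sq_integrable; apply/funext => y; congr cos; ring.
have L1 := LC x; have L2 := LC (- x).
have Z1 := sq_integrableZ 2^-1 L1; have Z2 := sq_integrableZ 2^-1 L2.
rewrite -!ipZl// -ipDl//.
rewrite [_ * nb q.*2 x]mulrC -ipZl//; last exact: sq_integrable_nb.
rewrite -[X in X - _](_ : ip (fun z => nb q.*2 x * nb q.*2 z) u = _) ?subrr//.
congr ip; apply/funext => y; rewrite !cos_pi_red !nb_double//.
have -> : q%:R * pi * (- x - y) = - (q%:R * pi * x + q%:R * pi * y) by ring.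
by rewrite cosN mulrBr cosB cosD mulrACA s2; field.
Qed.

Lemma defect_even_trig p x u : itv11 x -> sq_integrable u -> even_trig p ->
  exists N, forall n, (N <= n)%N -> defect n x p u = 0.
Proof.
move=> xI Lu; elim=> [m|f g Ef [N1 H1] Eg [N2 H2]|a f Ef [N H]].
- by exists m.*2.+1 => n; exact: defect_nb.
- exists (maxn N1 N2) => n; rewrite geq_max => /andP[h1 h2].
  by rewrite defectD ?H1 ?H2 ?addr0//; exact: sq_integrable_even_trig.
- exists N => n h; rewrite defectZ ?H ?mulr0//; exact: sq_integrable_even_trig.
Qed.

Lemma defect_cvg0 C u x : sq_integrable C -> sq_integrable u -> itv11 x ->
  (fun x => C (- x)) = C %[ae mu in itv11] ->
  defect n x C u @[n --> \oo] --> (0 : R).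
Proof.
move=> LC Lu xI Cev; apply/cvgrPdist_le.
change (forall e : R, 0 < e -> \forall n \near \oo, `|0 - defect n x C u| <= e) => e e0.
(* [t] is large enough for the [u] term to be at most [e / 2], and the added 1 keeps it positive.
   Then [e / (26 * t)] makes the term with factor [13 t] equal to [e / 2]. *)
pose t := (6 * ip u u + 1) / e.
have u0 := ip_ge0 u.
have t0 : 0 < t by rewrite /t divr_gt0//; lra.
have te : 3 * (ip u u / t) <= e / 2.
  have -> : 3 * (ip u u / t) = 3 * ip u u * e / (6 * ip u u + 1).
    by rewrite /t; field; rewrite !gt_eqF//; lra.
  rewrite ler_pdivrMr; last lra.
  nra.
have e1 : 0 < e / (26 * t) by rewrite divr_gt0// mulr_gt0.
have [p etp Hp] := even_density LC Cev e1.
have Lp := sq_integrable_even_trig etp.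
have [N HN] := defect_even_trig xI Lu etp.
exists N => // n /= Nn; rewrite sub0r normrN.
have -> : C = (fun z => (C z - p z) + p z) by apply/funext => z; rewrite subrK.
rewrite defectD ?HN ?addr0//; last exact: sq_integrableB.
apply: (le_trans (defect_le n xI t0 (sq_integrableB LC Lp) Lu)).
have -> : e = 13 * (t * (e / (26 * t))) + e / 2 by field; rewrite gt_eqF.
rewrite lerD// ler_wpM2l// ler_wpM2l//; exact: ltW.
Qed.

Theorem neumann_conv_real C u x : sq_integrable C -> sq_integrable u -> itv11 x ->
  (fun x => C (- x)) = C %[ae mu in itv11] ->
  series (nterm x C u) n @[n --> \oo] --> per_conv x C u + kappa C * ip (nb 0) u.
Proof.
move=> LC Lu xI Cev; have H := defect_cvg0 LC Lu xI Cev.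
have -> : (fun n => series (nterm x C u) n) =
    (fun n => per_conv x C u + kappa C * ip (nb 0) u - defect n x C u).
  by apply/funext => n; rewrite /defect /series/= opprB addrCA subrr addr0.
by rewrite -[X in _ --> X]subr0; apply: cvgB => //; exact: cvg_cst.
Qed.

End NeumannConvolution.

(** * Real and imaginary parts *)

Section ComplexAssembly.
Context {R : realType}.
Notation mu := (@lebesgue_measure R).
Notation normc := (@ComplexField.Normc.normc R).
Implicit Types (f g a b : R -> R) (C u G : R -> R[i]).

(** Elements of [L2C] are arbitrary off the interval; cutting makes them measurable on the line. The
    closed interval keeps the value at 1, which [C_1] and [C_2] use at [x = 0]. *)
Definition cut f : R -> R := f \_ `[-1, 1]%classic.

Lemma cutE f x : -1 <= x <= 1 -> cut f x = f x.
Proof. by move=> xI; rewrite /cut patchE ifT// inE/= in_itv. Qed.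

Lemma cut_itv11 f x : itv11 x -> cut f x = f x.
Proof. by rewrite /itv11/= in_itv/= => xI; rewrite cutE//; lra. Qed.

Lemma sq_integrable_cut f h : measurable_fun (itv11 : set (measurableTypeR R)) f ->
  mu.-integrable itv11 (EFin \o h) -> (forall x, f x ^+ 2 <= h x) ->
  sq_integrable (cut f).
Proof.
move=> mf ih fh; split.
  apply/(measurable_restrictT _ _).1; first exact: measurable_itv.
  exact: measurable_fun_itv_cc mf.
have mc : measurable_fun (itv11 : set (measurableTypeR R)) (cut f).
  by apply: eq_measurable_fun mf => x /set_mem xI; rewrite cut_itv11.
apply: le_integrable ih => //; first by apply/measurable_EFinP; exact: measurable_funX.
move=> x xI /=; rewrite lee_fin cut_itv11// ger0_norm ?sqr_ge0//.
by apply: (le_trans (fh x)); exact: ler_norm.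
Qed.

Lemma normc_sq (z : R[i]) : normc z ^+ 2 = complex.Re z ^+ 2 + complex.Im z ^+ 2.
Proof. by case: z => a b /=; rewrite sqr_sqrtr// addr_ge0// sqr_ge0. Qed.

Lemma normc_le (z : R[i]) : normc z <= `|complex.Re z| + `|complex.Im z|.
Proof.
rewrite -(ler_pXn2r (_ : 0 < 2)%N)// ?nnegrE ?addr_ge0//; last first.
  by case: z => a b; exact: sqrtr_ge0.
rewrite normc_sq -(real_normK (num_real (complex.Re z))) -(real_normK (num_real (complex.Im z))).
have := normr_ge0 (complex.Re z); have := normr_ge0 (complex.Im z); nra.
Qed.

Lemma L2C_Re C : L2C C -> sq_integrable (cut (fun x => complex.Re (C x))).
Proof.
move=> [m1 _ I]; apply: (@sq_integrable_cut _ (fun x => normc (C x) ^+ 2)) => // x.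
by rewrite normc_sq lerDl sqr_ge0.
Qed.

Lemma L2C_Im C : L2C C -> sq_integrable (cut (fun x => complex.Im (C x))).
Proof.
move=> [_ m1 I]; apply: (@sq_integrable_cut _ (fun x => normc (C x) ^+ 2)) => // x.
by rewrite normc_sq lerDr sqr_ge0.
Qed.

Definition parts G a b : Prop :=
  [/\ sq_integrable a, sq_integrable b &
      forall x, itv11 x -> G x = a x +i* b x].

Lemma L2C_parts G a b : parts G a b -> L2C G.
Proof.
move=> [La Lb H]; split.
- apply: (@eq_measurable_fun _ _ _ _ itv11 a); last exact: sq_integrable_measurable.
  by move=> x /set_mem/H ->.
- apply: (@eq_measurable_fun _ _ _ _ itv11 b); last exact: sq_integrable_measurable.
  by move=> x /set_mem/H ->.
have := integrableD measurable_itv11 La.2 Lb.2.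
by apply: eq_integrable => // x /set_mem/H E; rewrite normc_sq E.
Qed.

Lemma parts_cut C : L2C C ->
  parts C (cut (fun x => complex.Re (C x))) (cut (fun x => complex.Im (C x))).
Proof.
move=> hC; split; [exact: L2C_Re|exact: L2C_Im|].
by move=> x xI; rewrite !cut_itv11//=; case: (C x).
Qed.

Lemma cintegral_parts G a b : parts G a b ->
  cintegral G = (Num.sqrt 2 * ip (nb 0) a) +i* (Num.sqrt 2 * ip (nb 0) b).
Proof.
have E f : sq_integrable f -> \int[mu]_(y in itv11) f y = Num.sqrt 2 * ip (nb 0) f.
  move=> Lf; rewrite -ipZl//; last exact: sq_integrable_nb.
  by apply: eq_Rintegral => x _; rewrite /nb/= mulfV ?sqrt2_neq0// mul1r.
move=> [La Lb H]; rewrite -!E// /cintegral.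
by congr (_ +i* _); apply: eq_Rintegral => x /set_mem/H ->.
Qed.

Lemma cintegralM_parts G u a b ur ui : parts G a b -> parts u ur ui ->
  cintegral (fun y => G y * u y) = (ip a ur - ip b ui) +i* (ip a ui + ip b ur).
Proof.
move=> [La Lb H] [Lur Lui Hu]; rewrite /cintegral /ip.
rewrite -RintegralB//; [|exact: sq_integrableM..].
rewrite -RintegralD//; [|exact: sq_integrableM..].
by congr (_ +i* _); apply: eq_Rintegral => x /set_mem xI; rewrite (H _ xI) (Hu _ xI).
Qed.

Lemma inner_neumann_basis k u ur ui : parts u ur ui ->
  inner (neumann_basis k) u = ip (nb k) ur +i* ip (nb k) ui.
Proof.
move=> [Lur Lui Hu]; rewrite /inner /cintegral.
have E x : neumann_basis k x = (nb k x)%:C by rewrite /neumann_basis /nb; case: eqP.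
congr (_ +i* _); apply: eq_Rintegral => x /set_mem xI; rewrite E (Hu _ xI) /=.
  by rewrite oppr0 mul0r subr0.
by rewrite oppr0 mul0r addr0.
Qed.

Lemma conv_term_parts C u cr ci ur ui x k : parts C cr ci -> parts u ur ui ->
  conv_term neumann_basis C u x k =
    (nterm x cr ur k - nterm x ci ui k) +i* (nterm x cr ui k + nterm x ci ur k).
Proof.
move=> hC hu; rewrite /conv_term (inner_neumann_basis k hC) (inner_neumann_basis k hu).
have -> : neumann_basis k x = (nb k x)%:C by rewrite /neumann_basis /nb; case: eqP.
by rewrite /nterm; apply/eqP; rewrite eq_complex /=; apply/andP; split; apply/eqP; ring.
Qed.

Lemma half_complex : (2^-1 : R[i]) = (2^-1)%:C.
Proof. by rewrite fmorphV rmorph_nat. Qed.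

(** Used with the identity for [C_1] and [C_2] themselves, and with [red (s - y)] for their periodic
    extensions. Both [|tau y|] and [1 - |tau y|] lie in [[0, 1]], where [cut] changes nothing. *)
Lemma parts_C_tau C n tau : L2C C -> fold_map n tau ->
  let fr := cut (fun x => complex.Re (C x)) in let fi := cut (fun x => complex.Im (C x)) in
  sq_integrable (fun y => fr `|tau y|) -> sq_integrable (fun y => fold1 fr (tau y)) ->
  sq_integrable (fun y => fi `|tau y|) -> sq_integrable (fun y => fold1 fi (tau y)) ->
  parts (fun y => C_1 C (tau y))
    (fun y => 2^-1 * (fr `|tau y| + fold1 fr (tau y)))
    (fun y => 2^-1 * (fi `|tau y| + fold1 fi (tau y))) /\
  parts (fun y => C_2 C (tau y))
    (fun y => 2^-1 * (fr `|tau y| - fold1 fr (tau y)))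
    (fun y => 2^-1 * (fi `|tau y| - fold1 fi (tau y))).
Proof.
move=> hC [_ [cs _ Hcs]] fr fi L1 L2 L3 L4.
have H x : itv11 x -> [/\ fr `|tau x| = complex.Re (C `|tau x|),
    fold1 fr (tau x) = complex.Re (C (1 - `|tau x|)),
    fi `|tau x| = complex.Im (C `|tau x|) &
    fold1 fi (tau x) = complex.Im (C (1 - `|tau x|))].
  move=> /Hcs[tI _]; have t1 : `|tau x| <= 1 by rewrite ler_norml.
  by have t0 := normr_ge0 (tau x); split; rewrite /fold1 /fr /fi cutE//; lra.
split; split.
- by apply: sq_integrableZ; exact: sq_integrableD.
- by apply: sq_integrableZ; exact: sq_integrableD.
- move=> x /H[-> -> -> ->]; rewrite /C_1 half_complex.
  case: (C `|tau x|) => a b; case: (C (1 - `|tau x|)) => c d /=.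
  by apply/eqP; rewrite eq_complex/=; apply/andP; split; apply/eqP; ring.
- by apply: sq_integrableZ; exact: sq_integrableB.
- by apply: sq_integrableZ; exact: sq_integrableB.
- move=> x /H[-> -> -> ->]; rewrite /C_2 half_complex.
  case: (C `|tau x|) => a b; case: (C (1 - `|tau x|)) => c d /=.
  by apply/eqP; rewrite eq_complex/=; apply/andP; split; apply/eqP; ring.
Qed.

Lemma fold_id : fold_map 1 (id : R -> R).
Proof.
split; first exact: measurable_id.
exists [:: (0, false)] => // y; rewrite /itv11/= in_itv/= => yI.
by rewrite /signed_shift/= expr0 mul1r add0r eqxx; split=> //; lra.
Qed.

Lemma parts_C12 C : L2C C ->
  let fr := cut (fun x => complex.Re (C x)) in let fi := cut (fun x => complex.Im (C x)) in
  parts (C_1 C) (fun y => 2^-1 * (fr `|y| + fold1 fr y))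
    (fun y => 2^-1 * (fi `|y| + fold1 fi y)) /\
  parts (C_2 C) (fun y => 2^-1 * (fr `|y| - fold1 fr y))
    (fun y => 2^-1 * (fi `|y| - fold1 fi y)).
Proof.
move=> hC; have Lr := L2C_Re hC; have Li := L2C_Im hC.
apply: (parts_C_tau hC fold_id); try exact: sq_integrable_fold1;
  exact: (sq_integrable_fold fold_abs).
Qed.

(** Expanding [C_1] and [C_2] leaves the integral of [C |y|] with factor [1 / 2] and that of
    [C (1 - |y|)] with factor [- sqrt 2 / 2]. An integral is [sqrt 2] times the coefficient along
    [nb 0], which yields [kappa]. *)
Lemma k_N_parts C : L2C C ->
  k_N C = kappa (cut (fun x => complex.Re (C x))) +i* kappa (cut (fun x => complex.Im (C x))).
Proof.
move=> hC; have Lr := L2C_Re hC; have Li := L2C_Im hC.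
have [p1 p2] := parts_C12 hC.
rewrite /k_N (cintegral_parts p1) (cintegral_parts p2).
have L0 : sq_integrable (nb 0 : R -> R) := sq_integrable_nb 0.
have A1 := sq_integrable_fold fold_abs Lr; have A2 := sq_integrable_fold fold_abs Li.
have B1 := sq_integrable_fold1 Lr; have B2 := sq_integrable_fold1 Li.
have E f : sq_integrable (fun y => f `|y|) -> sq_integrable (fold1 f) ->
    - ((Num.sqrt 2 - 1) / 2) *
        (Num.sqrt 2 * ip (nb 0) (fun y => 2^-1 * (f `|y| + fold1 f y))) +
      (Num.sqrt 2 + 1) / 2 *
        (Num.sqrt 2 * ip (nb 0) (fun y => 2^-1 * (f `|y| - fold1 f y))) = kappa f.
  move=> h1 h2; have D := sq_integrableD h1 h2; have S := sq_integrableB h1 h2.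
  rewrite !ipZr ?ipBr ?ipDr//.
  rewrite (_ : kappa f = Num.sqrt 2 / 2 * ip (nb 0) (fun y => f `|y|) -
    Num.sqrt 2 * Num.sqrt 2 / 2 * ip (nb 0) (fold1 f)); first by field.
  by rewrite sqrt2_sq /kappa; field.
rewrite -(E _ A1 B1) -(E _ A2 B2).
by apply/eqP; rewrite eq_complex/=; apply/andP; split; apply/eqP; ring.
Qed.

Lemma periodic_parts C u ur ui s : L2C C -> parts u ur ui -> itv11 s ->
  let Q f g := ip (fun y => fold1 f (red (s - y))) g in
  let fr := cut (fun x => complex.Re (C x)) in let fi := cut (fun x => complex.Im (C x)) in
  2^-1 * cintegral (fun y => periodic_ext (C_1 C) (s - y) * u y)
  - 2^-1 * cintegral (fun y => periodic_ext (C_2 C) (s - y) * u y) =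
  (2^-1 * Q fr ur - 2^-1 * Q fi ui) +i* (2^-1 * Q fr ui + 2^-1 * Q fi ur).
Proof.
move=> hC hu sI Q fr fi; have Lr := L2C_Re hC; have Li := L2C_Im hC.
have [Lur Lui _] := hu.
have A1 := sq_integrable_red sI (sq_integrable_fold fold_abs Lr).
have A2 := sq_integrable_red sI (sq_integrable_fold fold_abs Li).
have B1 := sq_integrable_red sI (sq_integrable_fold1 Lr).
have B2 := sq_integrable_red sI (sq_integrable_fold1 Li).
have [p1 p2] := parts_C_tau hC (fold_red sI) A1 B1 A2 B2.
rewrite (cintegralM_parts p1 hu) (cintegralM_parts p2 hu) half_complex /Q.
have D1 := sq_integrableD A1 B1; have D2 := sq_integrableD A2 B2.
have S1 := sq_integrableB A1 B1; have S2 := sq_integrableB A2 B2.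
rewrite !ipZl// !ipBl// !ipDl//.
by apply/eqP; rewrite eq_complex/=; apply/andP; split; apply/eqP; rewrite -/fr -/fi; field.
Qed.

Lemma cvg_complex (f g : nat -> R) (a b : R) :
  f n @[n --> \oo] --> a -> g n @[n --> \oo] --> b ->
  (fun n => f n +i* g n : (R[i] : numFieldType)) n @[n --> \oo] -->
    (a +i* b : (R[i] : numFieldType)).
Proof.
move=> fa gb; apply/cvgrPdist_lt => e e0.
(* In the order of [R[i]] a positive element is real. *)
have [er ei] : 0 < complex.Re e /\ complex.Im e = 0.
  by move: e0; rewrite ltcE/= => /andP[/eqP <- ->].
have eE : e = (complex.Re e)%:C by case: e ei {e0 er} => x y /= ->.
have h0 : 0 < complex.Re e / 2 by lra.
move/cvgrPdist_lt/(_ _ h0): fa => fa; move/cvgrPdist_lt/(_ _ h0): gb => gb.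
near=> n.
rewrite eE.
suff H : normc ((a +i* b) - (f n +i* g n)) < complex.Re e by rewrite ltcE/= eqxx.
apply: (le_lt_trans (normc_le _)) => /=; rewrite [ltRHS]splitr; apply: ltrD.
  by near: n.
by near: n.
Unshelve. all: by end_near. Qed.

End ComplexAssembly.

Theorem mainTheorem17 (R : realType) (C : R -> R[i]) (hC : L2C C)
    (Ceven : (fun x => C (- x)) = C %[ae (@lebesgue_measure R) in itv11]) :
  [/\ L2C (C_1 C),
      L2C (C_2 C),
      C = (fun x => C_1 C x + C_2 C x) %[ae (@lebesgue_measure R) in itv11] &
      forall u : R -> R[i], L2C u -> forall x : R, itv11 x ->
        cvgn (series (fun k =>
          ComplexField.Normc.normc (conv_term neumann_basis C u x k))) /\
        basis_conv neumann_basis C u x =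
          2^-1 * cintegral (fun y => periodic_ext (C_1 C) (x - y) * u y)
          + 2^-1 * cintegral (fun y => periodic_ext (C_1 C) (- x - y) * u y)
          - 2^-1 * cintegral (fun y => periodic_ext (C_2 C) (x - y) * u y)
          - 2^-1 * cintegral (fun y => periodic_ext (C_2 C) (- x - y) * u y)
          + k_N C * inner (neumann_basis 0) u].
Proof.
have [p1 p2] := parts_C12 hC.
split; [exact: L2C_parts p1|exact: L2C_parts p2| |].
  apply: ae_eq_itv11S Ceven => x _ Cx.
  have -> : C_1 C x + C_2 C x = C `|x|.
    rewrite /C_1 /C_2 -mulrDr addrACA subrr addr0 -[C _ + C _]mulr2n.
    by rewrite -[C _ *+ 2]mulr_natl mulKf// pnatr_eq0.
  by have [_|_] := ger0P x.
move=> u hu x xI.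
have hCp := parts_cut hC; have hup := parts_cut hu.
have [Lcr Lci _] := hCp; have [Lur Lui _] := hup.
set cr := cut _ in hCp Lcr; set ci := cut (fun x => complex.Im (C x)) in hCp Lci.
set ur := cut _ in hup Lur; set ui := cut (fun x => complex.Im (u x)) in hup Lui.
have termE k := conv_term_parts x k hCp hup.
split.
  apply: nondecreasing_is_cvgn.
    apply/nondecreasing_seqP => n; rewrite seriesSr lerDl.
    by case: (conv_term _ _ _ _ _) => a b; exact: sqrtr_ge0.
  (* The case [t = 1] of [le_norm_sum_nterm], applied to the four products of real and imaginary
     parts. *)
  pose B f g : R := 1 * ip f f + ip g g / 1.
  exists (B cr ur + B ci ui + (B cr ui + B ci ur)) => _ [n _ <-].
  apply: (@le_trans _ _ (\sum_(0 <= k < n) `|nterm x cr ur k| +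
    \sum_(0 <= k < n) `|nterm x ci ui k| +
    (\sum_(0 <= k < n) `|nterm x cr ui k| + \sum_(0 <= k < n) `|nterm x ci ur k|))).
    rewrite -!big_split/=; apply: ler_sum => k _; rewrite termE.
    apply: (le_trans (normc_le _)) => /=; apply: lerD; first exact: ler_normB.
    exact: ler_normD.
  by do 2 apply: lerD; exact: le_norm_sum_nterm.
have CevRe : (fun x => cr (- x)) = cr %[ae (@lebesgue_measure R) in itv11].
  apply: ae_eq_itv11S Ceven => y yI /= E.
  by rewrite /cr !cut_itv11 ?E//; exact: itv11N.
have CevIm : (fun x => ci (- x)) = ci %[ae (@lebesgue_measure R) in itv11].
  apply: ae_eq_itv11S Ceven => y yI /= E.
  by rewrite /ci !cut_itv11 ?E//; exact: itv11N.
have rr := neumann_conv_real Lcr Lur xI CevRe.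
have ri := neumann_conv_real Lcr Lui xI CevRe.
have ir := neumann_conv_real Lci Lur xI CevIm.
have ii := neumann_conv_real Lci Lui xI CevIm.
have := cvg_complex (cvgB rr ii) (cvgD ri ir).
set a := _ - _; set b := _ + _ => H.
have -> : basis_conv neumann_basis C u x = a +i* b.
  have E n : series (conv_term neumann_basis C u x : nat -> (R[i] : numFieldType)) n =
      (series (nterm x cr ur) n - series (nterm x ci ui) n) +i*
      (series (nterm x cr ui) n + series (nterm x ci ur) n).
    rewrite /series/=; elim: n => [|n IH].
      by rewrite !big_geq// subr0 addr0.
    rewrite !big_nat_recr//= IH termE.
    by apply/eqP; rewrite eq_complex/=; apply/andP; split; apply/eqP; ring.
  suff K : (series (conv_term neumann_basis C u x : nat -> (R[i] : numFieldType))) @ \oo -->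
      (a +i* b : (R[i] : numFieldType)).
    exact: (cvg_lim (@norm_hausdorff _ _) K).
  by rewrite (funext E); exact: H.
rewrite (k_N_parts hC) (inner_neumann_basis 0 hup) -/cr -/ci.
have P1 := periodic_parts hC hup xI; have P2 := periodic_parts hC hup (itv11N xI).
(* The integrals of [C_1] and [C_2] with the same shift are brought together, the form that
   [periodic_parts] expects. *)
rewrite (addrAC _ _ (- (2^-1 * cintegral (fun y => periodic_ext (C_2 C) (x - y) * u y)))).
rewrite -(addrA (_ - _) (2^-1 * _) (- _)).
rewrite P1 P2 -/cr -/ci /a /b /per_conv.
by apply/eqP; rewrite eq_complex/=; apply/andP; split; apply/eqP; ring.
Qed.
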